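(* Let $V\in L^1_{loc}(\Omega)$ be such that $Q_V\succeq0$ in $\Omega$. Then $-\Delta+V$ is $L^1$-subcritical in $\Omega$ if and only if there exist $u\in\mathcal H_V(\Omega)$ and $f\in L^1_{loc}(\Omega)$ with $\inf_B f>0$ for every ball $B\Subset\Omega$ such that $-\Delta u+Vu=f$ in $\Omega$ in the energy sense, i.e. $a_{V,\Omega}(u,\xi)=\int_\Omega f\xi\,dx$ for all $\xi\in W^{1,\infty}_c(\Omega)$.
   Context: $\Omega$ is a domain (nonempty connected open set) in $\mathbb R^N$, $N\ge1$. $W^{1,\infty}_c(\Omega)$ is the space of Lipschitz continuous functions with compact support in $\Omega$; $Q_V(\xi)=\int_\Omega\{|\nabla\xi|^2+V\xi^2\}\,dx$, and $Q_V\succeq0$ in $\Omega$ means $Q_V(\xi)\ge0$ for all $\xi\in W^{1,\infty}_c(\Omega)$. When $Q_V\succeq 0$, $(\xi,\phi)\mapsto\int_\Omega\{\nabla\xi\cdot\nabla\phi+V\xi\phi\}$ is an inner product on $W^{1,\infty}_c(\Omega)$ with norm $\sqrt{Q_V}$; $\mathcal L_V(\Omega)=(W^{1,\infty}_c(\Omega),\sqrt{Q_V})$ is this pre-Hilbert space, $\mathcal H_V(\Omega)$ its Hilbert space completion and $a_{V,\Omega}$ the inner product of $\mathcal H_V(\Omega)$. The operator $-\Delta+V$ is $L^1$-subcritical in $\Omega$ if $Q_V\succeq0$ in $\Omega$ and $\mathcal L_V(\Omega)\hookrightarrow L^1_{loc}(\Omega)$ continuously, i.e. for every compact $K\subset\Omega$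 there is $C_K$ with $\int_K|\xi|\le C_K\sqrt{Q_V(\xi)}$ for all $\xi\in W^{1,\infty}_c(\Omega)$. $\inf$ denotes the essential infimum; $B\Subset\Omega$ means $\overline B$ is a compact subset of $\Omega$. *)

(* Defs.v *)
From HB Require Import structures.
From mathcomp Require Import all_boot all_order all_algebra.
From mathcomp Require Import all_classical all_reals all_analysis.
From mathcomp Require Import ring lra.

Set Implicit Arguments.
Unset Strict Implicit.
Unset Printing Implicit Defensive.

Import Order.TTheory GRing.Theory Num.Theory.
Import numFieldNormedType.Exports.

Local Open Scope classical_set_scope.
Local Open Scope ring_scope.

(* R^n is 'rV[R]_n. Its norm in the library is the sup norm, which gives the
   usual topology, compact sets and Lipschitz functions; Euclidean balls are
   [eball] below. Its sigma-algebra is generated by the coordinates, as the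
   library does for tuples: it is the Borel sigma-algebra. *)
Definition measure_rV_display : measure_display -> measure_display.
Proof. exact. Qed.

Section measurable_rV.
Context {R : realType}.
Variable n : nat.

Let coords : 'I_n -> 'rV[R]_n -> R := fun i x => x ord0 i.

Let rV_set0 : g_sigma_preimage coords set0.
Proof. exact: sigma_algebra0. Qed.

Let rV_setC A : g_sigma_preimage coords A -> g_sigma_preimage coords (~` A).
Proof. exact: sigma_algebraC. Qed.

Let rV_bigcup (F : _^nat) : (forall i, g_sigma_preimage coords (F i)) ->
  g_sigma_preimage coords (\bigcup_i (F i)).
Proof. exact: sigma_algebra_bigcup. Qed.

HB.instance Definition _ :=
  @isMeasurable.Build (measure_rV_display default_measure_display)
    'rV[R]_n (g_sigma_preimage coords) rV_set0 rV_setC rV_bigcup.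

Lemma measurable_coord (i : 'I_n) :
  measurable_fun setT (fun x : 'rV[R]_n => x ord0 i).
Proof.
move=> _ Y mY; rewrite setTI; apply: sub_sigma_algebra => /=.
rewrite -bigcup_seq/=; exists i => /=; first by rewrite mem_index_enum.
by exists Y => //; rewrite setTI.
Qed.

Lemma measurable_fun_rV d (T : measurableType d) (f : T -> 'rV[R]_n) :
  (forall i, measurable_fun setT (fun x => f x ord0 i)) ->
  measurable_fun setT f.
Proof.
move=> mf _ A mA; rewrite setTI.
suff : g_sigma_preimage coords `<=` [set B | measurable (f @^-1` B)] by exact.
apply: smallest_sub.
  split=> [|B /= mB|F /= mF]; first by rewrite /= preimage_set0.
    by rewrite setTD preimage_setC; exact: measurableC.
  by rewrite preimage_bigcup; exact: bigcup_measurable.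
rewrite -bigcup_seq; apply: bigcup_sub => i _ _ [B mB <-] /=.
by rewrite setTI; have := mf i measurableT B mB; rewrite setTI.
Qed.

End measurable_rV.

(* Lebesgue measure on R^n: point mass on R^0, and the image on R^(n+1) of the
   product of the Lebesgue measures on R and R^n under (t, x) |-> (t, x). *)
Section lebesgue_measure_rV.
Context {R : realType}.

Section step.
Variables (n : nat) (mu : {sigma_finite_measure set 'rV[R]_n -> \bar R}).

Definition row_cons (p : measurableTypeR R * 'rV[R]_n) : 'rV[R]_n.+1 :=
  row_mx (const_mx p.1 : 'rV[R]_1) p.2.

Lemma row_consEl p (j : 'I_1) : row_cons p ord0 (lshift n j) = p.1.
Proof. exact: etrans (row_mxEl _ _ _ _) (mxE _ _ _ _). Qed.

Lemma row_consEr p (j : 'I_n) : row_cons p ord0 (rshift 1 j) = p.2 ord0 j.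
Proof. exact: row_mxEr. Qed.

Lemma measurable_row_cons : measurable_fun setT row_cons.
Proof.
apply: measurable_fun_rV => i; case: (split_ordP (i : 'I_(1 + n))) => j ->.
  rewrite (_ : (fun _ => _) = fst); first exact: measurable_fst.
  by apply/funext => p; rewrite row_consEl.
rewrite (_ : (fun _ => _) = (fun x : 'rV_n => x ord0 j) \o snd).
  exact: measurableT_comp (measurable_coord j) measurable_snd.
by apply/funext => p; rewrite row_consEr.
Qed.

HB.instance Definition _ :=
  isMeasurableFun.Build _ _ _ _ row_cons measurable_row_cons.

Definition lebesgue_measure_rVS :=
  pushforward (@lebesgue_measure R \x mu)%E row_cons.

Let leb0 : lebesgue_measure_rVS set0 = 0%E.
Proof. exact: measure0. Qed.

Let leb_ge0 A : (0 <= lebesgue_measure_rVS A)%E.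
Proof. exact: measure_ge0. Qed.

Let leb_sigma_additive : semi_sigma_additive lebesgue_measure_rVS.
Proof. exact: measure_semi_sigma_additive. Qed.

HB.instance Definition _ := isMeasure.Build _ _ _ lebesgue_measure_rVS
  leb0 leb_ge0 leb_sigma_additive.

Definition row_uncons (x : 'rV[R]_n.+1) : measurableTypeR R * 'rV[R]_n :=
  (x ord0 ord0, \row_(j < n) x ord0 (lift ord0 j)).

Lemma row_consK : cancel row_cons row_uncons.
Proof.
move=> [t y]; rewrite /row_uncons; congr pair.
  by rewrite -[RHS]/((t, y).1) -(row_consEl (t, y) ord0); congr (_ _ _); exact: val_inj.
apply/rowP => j; rewrite mxE -[RHS]/((t, y).2 ord0 j) -row_consEr.
by congr (_ _ _); exact: val_inj.
Qed.

Lemma measurable_row_uncons : measurable_fun setT row_uncons.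
Proof.
apply/measurable_fun_pairP; split; first exact: measurable_coord.
apply: measurable_fun_rV => j.
rewrite (_ : (fun _ => _) = fun x : 'rV_n.+1 => x ord0 (lift ord0 j)).
  exact: measurable_coord.
by apply/funext => x; rewrite mxE.
Qed.

Let leb_sigma_finite : sigma_finite setT lebesgue_measure_rVS.
Proof.
have /sigma_finiteP[F [FT ndF Foo]] := sigma_finiteT (@lebesgue_measure R).
have /sigma_finiteP[G [GT ndG Goo]] := sigma_finiteT mu.
exists (fun k => row_uncons @^-1` (F k `*` G k)) => [|k].
  rewrite -preimage_bigcup -[LHS](preimage_setT row_uncons); congr (_ @^-1` _).
  rewrite -setXTT FT GT; apply/seteqP; split=> [[x y]|[x y] [k _ []]].
    move=> [[i _ Fix] [j _ Gjy]]; exists (maxn i j) => //; split.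
      by move/subsetPset : (ndF _ _ (leq_maxl i j)); exact.
    by move/subsetPset : (ndG _ _ (leq_maxr i j)); exact.
  by move=> Fkx Gky; split; exists k.
have [[mF Fk] [mG Gk]] := (Foo k, Goo k); split.
  by rewrite -[_ @^-1` _]setTI; apply: measurable_row_uncons => //; exact: measurableX.
rewrite /lebesgue_measure_rVS /pushforward -comp_preimage.
rewrite (_ : row_uncons \o row_cons = id); last exact/funext/row_consK.
by rewrite preimage_id product_measure1E// lte_mul_pinfty// ge0_fin_numE.
Qed.

HB.instance Definition _ := Measure_isSigmaFinite.Build _ _ _
  lebesgue_measure_rVS leb_sigma_finite.

End step.

Fixpoint lebesgue_measure_rV n :
    {sigma_finite_measure set 'rV[R]_n -> \bar R} :=
  if n is m.+1 then lebesgue_measure_rVS (lebesgue_measure_rV m)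
  else @dirac _ 'rV[R]_0 0 R.

End lebesgue_measure_rV.
Arguments lebesgue_measure_rV {R n}.

Lemma lebesgue_measure_rV_box (R : realType) n (A : 'I_n -> set R) :
  (forall i, measurable (A i)) ->
  lebesgue_measure_rV [set x : 'rV[R]_n | forall i, A i (x ord0 i)] =
  (\prod_(i < n) @lebesgue_measure R (A i))%E.
Proof.
elim: n A => [|n IHn] A mA.
  by rewrite big_ord0 /= diracE mem_set// => -[].
pose B := [set y : 'rV[R]_n | forall j, A (lift ord0 j) (y ord0 j)].
have mB : measurable B.
  rewrite (_ : B = \bigcap_(j in [set: 'I_n])
    ((fun y : 'rV_n => y ord0 j) @^-1` A (lift ord0 j))); last first.
    by apply/seteqP; split=> [y By j _|y By j]; exact: By.
  apply: fin_bigcap_measurable => [|j _]; first exact: finite_finset.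
  by rewrite -[_ @^-1` _]setTI; exact: measurable_coord.
rewrite big_ord_recl -IHn// /= /lebesgue_measure_rVS /pushforward.
rewrite -product_measure1E//; last exact: (mA ord0).
congr (product_measure1 _ _ _).
have E0 : ord0 = lshift n (ord0 : 'I_1) by exact: val_inj.
have ES j : lift ord0 j = rshift 1 j :> 'I_(1 + n) by exact: val_inj.
apply/seteqP; split=> [[t y] /= Aty|[t y] /= [At By] i].
  split; first by have := Aty ord0; rewrite [X in row_cons _ _ X]E0 row_consEl.
  by move=> j; have := Aty (lift ord0 j); rewrite [X in row_cons _ _ X]ES row_consEr.
case: (unliftP ord0 i) => [j|] ->; last by rewrite [X in row_cons _ _ X]E0 row_consEl.
by rewrite [X in row_cons _ _ X]ES row_consEr; exact: By.
Qed.

(* Completion of (E, ip), for a positive semidefinite symmetric bilinear form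
   ip: Cauchy sequences for the norm sqrt (ip x x) modulo null sequences. An
   element is the set of all Cauchy sequences in one equivalence class. *)
Section hilbert_completion.
Context {R : realType} {E : lmodType R}.
Variable ip : E -> E -> R.
Implicit Types (u v : nat -> E) (x y z : E).

Definition ip_norm x := Num.sqrt (ip x x).

Definition ip_cauchy u := forall e : R, 0 < e ->
  exists k, forall m n, (k <= m)%N -> (k <= n)%N -> ip_norm (u m - u n) < e.

Definition ip_equiv u v := (fun n => ip_norm (u n - v n)) @ \oo --> (0 : R).

Definition ip_class u : set (nat -> E) :=
  [set v | ip_cauchy v /\ ip_equiv u v].

Definition completion :=
  {C : set (nat -> E) | exists2 u, ip_cauchy u & C = ip_class u}.

Definition completion_repr (C : completion) : nat -> E :=
  xget (fun=> 0) (sval C).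

(* For a positive semidefinite form the limit exists (is_cvg_ip) and does not
   depend on the representatives (completion_ipE). *)
Definition completion_ip (C D : completion) : R :=
  limn (fun n => ip (completion_repr C n) (completion_repr D n)).

Hypothesis ip00 : ip 0 0 = 0.

Lemma ip_cauchy_cst x : ip_cauchy (fun=> x).
Proof.
by move=> e e0; exists 0 => m n _ _; rewrite subrr /ip_norm ip00 sqrtr0.
Qed.

Definition to_completion x : completion :=
  exist _ (ip_class (fun=> x))
    (ex_intro2 _ _ (fun=> x) (ip_cauchy_cst x) erefl).

End hilbert_completion.

Section completion_theory.
Context {R : realType} {E : lmodType R}.
Variable ip : E -> E -> R.
Hypothesis ipC : forall x y, ip x y = ip y x.
Hypothesis ipDl : forall x y z, ip (x + y) z = ip x z + ip y z.
Hypothesis ipZl : forall (a : R) x z, ip (a *: x) z = a * ip x z.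
Hypothesis ip_ge0 : forall x, 0 <= ip x x.
Implicit Types (u v : nat -> E) (x y z : E).

Local Notation N := (ip_norm ip).

Let ipDr x y z : ip x (y + z) = ip x y + ip x z.
Proof. by rewrite ipC ipDl !(ipC x). Qed.

Let ipZr a x z : ip x (a *: z) = a * ip x z.
Proof. by rewrite ipC ipZl ipC. Qed.

Let ipBl x y z : ip (x - y) z = ip x z - ip y z.
Proof. by rewrite ipDl -scaleN1r ipZl mulN1r. Qed.

Let ipBr x y z : ip x (y - z) = ip x y - ip x z.
Proof. by rewrite ipC ipBl !(ipC x). Qed.

Let N2 x : N x ^+ 2 = ip x x.
Proof. by rewrite sqr_sqrtr. Qed.

Lemma ip_cauchy_schwarz x y : `|ip x y| <= N x * N y.
Proof.
rewrite -sqrtrM// -sqrtr_sqr ler_wsqrtr//.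
have P t : 0 <= ip x x + 2 * t * ip x y + t ^+ 2 * ip y y.
  have := ip_ge0 (x + t *: y).
  by rewrite ipDl !ipDr !ipZl !ipZr (ipC y x); lra.
have [y0|y0] := eqVneq (ip y y) 0.
  rewrite y0 mulr0; have [->|xy0] := eqVneq (ip x y) 0; first by rewrite expr0n.
  have := P (- (ip x x + 1) / (2 * ip x y)); rewrite y0 mulr0 addr0.
  rewrite (_ : 2 * _ * _ = - (ip x x + 1)); last by field.
  by lra.
have yp : 0 < ip y y by rewrite lt_neqAle eq_sym y0 ip_ge0.
have := P (- ip x y / ip y y).
rewrite (_ : ip x x + _ + _ = (ip x x * ip y y - ip x y ^+ 2) / ip y y); last first.
  by field.
by rewrite pmulr_lge0 ?invr_gt0// subr_ge0.
Qed.

Lemma ip_normD x y : N (x + y) <= N x + N y.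
Proof.
rewrite -(@ler_pXn2r _ 2) ?nnegrE ?addr_ge0 ?sqrtr_ge0//.
rewrite sqrrD !N2 ipDl !ipDr (ipC y x).
by have := ler_norm (ip x y); have := ip_cauchy_schwarz x y; lra.
Qed.

Lemma ip_normN x : N (- x) = N x.
Proof. by rewrite /ip_norm -scaleN1r ipZl ipZr !mulN1r opprK. Qed.

Lemma ip_cauchy_bounded u : ip_cauchy ip u -> exists M, forall n, N (u n) <= M.
Proof.
move=> /(_ 1 ltr01)[k uk].
exists (1 + N (u k) + \sum_(i < k) N (u i)) => n.
have S0 : 0 <= \sum_(i < k) N (u i) by apply: sumr_ge0 => i _; exact: sqrtr_ge0.
have [kn|nk] := leqP k n; last first.
  rewrite (bigD1 (Ordinal nk))//=.
  have : 0 <= \sum_(i < k | i != Ordinal nk) N (u i).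
    by apply: sumr_ge0 => i _; exact: sqrtr_ge0.
  by have : 0 <= N (u k) by [exact: sqrtr_ge0]; lra.
rewrite -(subrK (u k) (u n)) (le_trans (ip_normD _ _))//.
by have := uk _ _ kn (leqnn k); lra.
Qed.

Let ip_sub x y z t : `|ip x y - ip z t| <= N (x - z) * N y + N z * N (y - t).
Proof.
rewrite (_ : _ - _ = ip (x - z) y + ip z (y - t)); last by rewrite ipBl ipBr; lra.
by rewrite (le_trans (ler_normD _ _))// lerD// ip_cauchy_schwarz.
Qed.

Lemma is_cvg_ip u v : ip_cauchy ip u -> ip_cauchy ip v ->
  cvgn (fun n => ip (u n) (v n)).
Proof.
move=> cu cv; apply/cauchy_cvgP/cauchy_exP => e e0.
have [A uA] := ip_cauchy_bounded cu; have [B vB] := ip_cauchy_bounded cv.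
have A0 : 0 <= A by exact: le_trans (sqrtr_ge0 _) (uA 0%N).
have B0 : 0 <= B by exact: le_trans (sqrtr_ge0 _) (vB 0%N).
have AB0 : 0 < A + B + 1 by lra.
have d0 : 0 < e / (A + B + 1) by rewrite divr_gt0.
have [k uk] := cu _ d0; have [l vl] := cv _ d0.
pose m := maxn k l; exists (ip (u m) (v m)).
exists m => // n /= mn; rewrite /ball/= (le_lt_trans (ip_sub _ _ _ _))//.
have un := uk _ _ (leq_maxl k l) (leq_trans (leq_maxl k l) mn).
have vn := vl _ _ (leq_maxr k l) (leq_trans (leq_maxr k l) mn).
have -> : e = e / (A + B + 1) * (A + B + 1) by rewrite divfK// gt_eqF.
set d := e / _ in un vn d0 *.
have ub := ler_pM (sqrtr_ge0 _) (sqrtr_ge0 _) (ltW un) (vB m).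
have vb := ler_pM (sqrtr_ge0 _) (sqrtr_ge0 _) (uA n) (ltW vn).
rewrite (le_lt_trans (lerD ub vb))//; nra.
Qed.

Lemma lim_ip_equiv u v u' v' : ip_cauchy ip u -> ip_cauchy ip v ->
  ip_cauchy ip v' -> ip_equiv ip u u' -> ip_equiv ip v v' ->
  ip_cauchy ip u' ->
  limn (fun n => ip (u n) (v n)) = limn (fun n => ip (u' n) (v' n)).
Proof.
move=> cu cv cv' uu' vv' cu'.
have [A u'A] := ip_cauchy_bounded cu'; have [B vB] := ip_cauchy_bounded cv.
apply/eqP; rewrite -subr_eq0; apply/eqP.
rewrite -limB; [|exact: is_cvg_ip|exact: is_cvg_ip].
pose w n : R^o := ip (u n) (v n) - ip (u' n) (v' n).
suff /cvg_lim -> : w @ \oo --> (0 : R^o) by [].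
apply/norm_cvg0P.
have b0 : (fun n => N (u n - u' n) * B + A * N (v n - v' n)) @ \oo --> (0 : R).
  rewrite (_ : 0 = 0 * (B : R) + (A : R) * 0); last by rewrite mul0r mulr0 addr0.
  by apply: cvgD; [exact: cvgMr_tmp|exact: cvgMl_tmp].
apply: (squeeze_cvgr _ (cvg_cst 0) b0).
apply: nearW => n /=; rewrite normr_ge0 /=.
rewrite (le_trans (ip_sub _ _ _ _))// lerD//.
  by rewrite ler_wpM2l ?sqrtr_ge0.
by rewrite ler_wpM2r ?sqrtr_ge0.
Qed.

Lemma completion_ipE u v (C D : completion ip) :
  ip_cauchy ip u -> ip_cauchy ip v ->
  sval C = ip_class ip u -> sval D = ip_class ip v ->
  completion_ip C D = limn (fun n => ip (u n) (v n)).
Proof.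
have refl w : ip_cauchy ip w -> ip_class ip w w.
  move=> cw; split=> //; rewrite /ip_equiv.
  rewrite (_ : (fun _ => _) = fun=> 0); first exact: cvg_cst.
  apply/funext => n; rewrite subrr /ip_norm.
  by rewrite -(scale0r 0) ipZl mul0r sqrtr0.
move=> cu cv Cu Dv; rewrite /completion_ip /completion_repr Cu Dv.
have [cu' uu'] : ip_class ip u (xget (fun=> 0) (ip_class ip u)).
  exact: xgetI (refl _ cu).
have [cv' vv'] : ip_class ip v (xget (fun=> 0) (ip_class ip v)).
  exact: xgetI (refl _ cv).
exact/esym/lim_ip_equiv.
Qed.

Lemma completion_ip_iota (ip00 : ip 0 0 = 0) x y :
  completion_ip (to_completion ip00 x) (to_completion ip00 y) = ip x y.
Proof.
rewrite (@completion_ipE (fun=> x) (fun=> y))//; try exact: ip_cauchy_cst.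
exact: lim_cst.
Qed.

End completion_theory.

Section test_functions.
Context {R : realType} {N : nat}.
Implicit Types (Om : set 'rV[R]_N) (f : 'rV[R]_N -> R).

Definition supp f : set 'rV[R]_N := closure [set x | f x != 0].

(* W^{1,oo}_c(Om): a function on Om with compact support in Om is represented
   by its extension by 0 to R^N. *)
Definition lipc Om : {pred 'rV[R]_N -> R} :=
  mem [set f | [/\ [lipschitz (f x : R^o) | x in Om],
                   compact (supp f) & supp f `<=` Om]].

Lemma lipc_submod_closed Om : submod_closed (lipc Om).
Proof.
split=> [|a f g]; rewrite !inE /=.
  have s0 : supp 0 = set0.
    by rewrite /supp (_ : mkset _ = set0) ?closure0//; apply/seteqP; split=> x /=;
      rewrite ?eqxx.
  split; rewrite ?s0//; last exact: compact0.
  exists 0; split; first exact: real0.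
  by move=> M M0 [x y] /= _; rewrite subrr normr0 mulr_ge0// ltW.
move=> [[Mf [_ fM]] cf fOm] [[Mg [_ gM]] cg gOm].
have sub : supp (a *: f + g) `<=` supp f `|` supp g.
  rewrite /supp -closureU; apply: closure_subset => x /=.
  apply: contraPP => /not_orP[/negP + /negP]; rewrite !negbK => /eqP f0 /eqP g0.
  by rewrite /= !fctE f0 g0 scaler0 addr0 eqxx.
split; last by move=> x /sub[/fOm|/gOm].
  exists (`|a| * (`|Mf| + 1) + (`|Mg| + 1)); split; first exact: num_real.
  move=> M ltM [x y] /= [Omx Omy].
  have F : `|f x - f y| <= (`|Mf| + 1) * `|x - y|.
    by apply: (fM (`|Mf| + 1) _ (x, y)) => //; have := ler_norm Mf; lra.
  have G : `|g x - g y| <= (`|Mg| + 1) * `|x - y|.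
    by apply: (gM (`|Mg| + 1) _ (x, y)) => //; have := ler_norm Mg; lra.
  rewrite (le_trans _ (ler_wpM2r (normr_ge0 _) (ltW ltM)))//.
  rewrite !fctE (_ : _ - _ = a * (f x - f y) + (g x - g y)); last first.
    by rewrite /GRing.scale/=; lra.
  rewrite mulrDl (le_trans (ler_normD _ _))// lerD// normrM -mulrA.
  by rewrite ler_wpM2l.
by apply: (subclosed_compact (@closed_closure _ _) _ sub); exact: compactU.
Qed.

HB.instance Definition _ Om :=
  GRing.isSubmodClosed.Build R _ (lipc Om) (lipc_submod_closed Om).

Record test_fun Om := TestFun {
  test_fun_val :> 'rV[R]_N -> R;
  _ : test_fun_val \in lipc Om }.

HB.instance Definition _ Om := [isSub for @test_fun_val Om].
HB.instance Definition _ Om := [Choice of test_fun Om by <:].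
HB.instance Definition _ Om := [SubChoice_isSubLmodule of test_fun Om by <:].

End test_functions.

Section schrodinger.
Context {R : realType} {N : nat}.
Implicit Types (Om : set 'rV[R]_N) (V f : 'rV[R]_N -> R).
Local Notation mu := (@lebesgue_measure_rV R N).

Definition domain Om := [/\ Om !=set0, open Om & connected Om].

(* f is a Borel representative; its values outside Om are irrelevant *)
Definition L1loc Om f := measurable_fun Om f /\
  forall K, compact K -> K `<=` Om -> mu.-integrable K (EFin \o f).

Definition eball (x : 'rV[R]_N) (r : R) : set 'rV[R]_N :=
  [set y | \sum_(i < N) (y ord0 i - x ord0 i) ^+ 2 < r ^+ 2].

(* ess_inf of the library, with "almost everywhere" relative to B *)
Definition ess_inf_on (B : set 'rV[R]_N) f : \bar R :=
  ereal_sup [set y | \forall x \ae mu, B x -> (y <= (f x)%:E)%E].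

(* i-th partial derivative; Lipschitz functions have all of them almost
   everywhere, and the value is 0 where the derivative does not exist *)
Definition partial (i : 'I_N) f (x : 'rV[R]_N) : R :=
  'D_(delta_mx ord0 i) (f : 'rV[R]_N -> R^o) x.

Definition Q Om V (xi : test_fun Om) : R :=
  (\int[mu]_(x in Om)
     ((\sum_(i < N) partial i xi x ^+ 2) + V x * xi x ^+ 2))%R.

Definition energy Om V (xi phi : test_fun Om) : R :=
  (\int[mu]_(x in Om)
     ((\sum_(i < N) partial i xi x * partial i phi x) + V x * xi x * phi x))%R.

Lemma energyE Om V (xi : test_fun Om) : energy V xi xi = Q V xi.
Proof.
by apply: eq_Rintegral => x _; rewrite expr2 mulrA.
Qed.

Lemma energy00 Om V : energy V (0 : test_fun Om) 0 = 0.
Proof.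
rewrite energyE /Q (@eq_Rintegral _ _ _ _ _ (cst 0)) => [|x _].
  by rewrite /Rintegral integral0.
rewrite big1 => [|i _]; last first.
  by rewrite /partial [X in X ^+ 2](derive_cst (0 : R^o)) expr0n.
by rewrite expr0n mulr0 addr0.
Qed.

Definition Q_nonneg Om V := forall xi : test_fun Om, 0 <= Q V xi.

Definition H_V Om V := completion (@energy Om V).

Definition a_V Om V (u w : H_V Om V) : R := completion_ip u w.

Definition incl_H_V Om V (xi : test_fun Om) : H_V Om V :=
  to_completion (energy00 Om V) xi.

Definition L1_subcritical Om V := Q_nonneg Om V /\
  forall K, compact K -> K `<=` Om ->
    exists C : R, forall xi : test_fun Om,
      (\int[mu]_(x in K) `|xi x|)%R <= C * Num.sqrt (Q V xi).

Definition energy_solution Om V (u : H_V Om V) f :=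
  forall xi : test_fun Om,
    a_V u (incl_H_V V xi) = (\int[mu]_(x in Om) (f x * xi x))%R.

End schrodinger.

(* Main.v *)
Require Import Defs.
From HB Require Import structures.
From mathcomp Require Import all_boot all_order all_algebra.
From mathcomp Require Import all_classical all_reals all_analysis measurable_realfun.
From mathcomp Require Import ring lra.

(** If [u] solves [- Delta u + V u = f] in the energy sense with [f] bounded
    below by positive constants on compact sets, test the equation with [|xi|].
    Cauchy-Schwarz in the completion gives
      c_K \int_K |xi| <= \int f |xi| = a_V (u, |xi|) <= ||u|| sqrt (Q |xi|),
    and [Q |xi| <= Q xi], because passing to the absolute value never increases
    the square of a directional derivative ([derive_norm_le]). This is the
    L^1-subcritical estimate ([energy_solution_subcritical]).

    Conversely, exhaust [Om] by compact sets [K_k], let [C_k] be the constants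
    of the subcritical estimate, and take [f = \sum_k b_k 1_(K_k)] with [b_k > 0]
    so small that [b_k C_k <= 2 ^ - k.+1]. Then [f] is bounded, it is at least
    [b_k] on [K_k], and [|\int f xi| <= sqrt (Q xi)] ([exists_positive_source]).
    The right-hand side is therefore a bounded linear functional, which the
    completion represents. [riesz_completion] builds the representing Cauchy
    sequence directly, as a minimizing sequence of the Dirichlet functional
    [Q x - 2 l x].

    Both directions use that the energy is a positive semidefinite symmetric
    bilinear form ([energy_linear]). Additivity is the delicate point: the
    partial derivatives of a sum add up only where they exist, so the proof
    rests on the almost everywhere existence of partial derivatives of
    Lipschitz functions. On the line this follows from the Radon-Nikodym and
    Lebesgue differentiation theorems ([lipschitz_ae_derivable]); in R^n it
    holds on every line parallel to an axis, and Fubini's theorem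
    ([null_lines]) applies once the set of differentiability is known to be
    Borel ([measurable_derivable_set]). *)

Set Implicit Arguments.
Unset Strict Implicit.
Unset Printing Implicit Defensive.

Import Order.TTheory GRing.Theory Num.Theory.
Import numFieldNormedType.Exports.

Local Open Scope classical_set_scope.
Local Open Scope ring_scope.

(** * Preliminaries *)

Lemma nbhs_rat (R : realType) (h : R) (P : set R) :
  nbhs h P -> exists a : rat, P (ratr a).
Proof.
move=> /nbhs_ballP[e /= e0 eP].
have [a] := @rat_in_itvoo R (h - e) (h + e) ltac:(lra).
by rewrite in_itv/= -ltr_distlC => ah; exists a; exact: eP.
Qed.

Lemma natSinv_lt (R : realType) (e : R) : 0 < e -> exists k : nat, k.+1%:R^-1 < e.
Proof.
move=> e0; have [k _ /(_ k (leqnn k)) ke] := near_infty_natSinv_lt (PosNum e0).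
by exists k.
Qed.

Lemma lipschitz_continuous (R : realType) (U W : normedModType R)
    (f : U -> W) (L : R) :
  (forall x y, `|f x - f y| <= L * `|x - y|) -> continuous f.
Proof.
move=> fL x; apply/cvgrPdist_le => e e0; near=> y.
rewrite (le_trans (fL _ _))//.
have : `|x - y| <= e / (`|L| + 1).
  near: y; apply: cvgr_dist_le; first exact: cvg_id.
  by rewrite divr_gt0// ltr_wpDl.
rewrite ler_pdivlMr ?ltr_wpDl//.
by have := normr_ge0 (x - y); have := ler_norm L; nra.
Unshelve. all: by end_near.
Qed.

Lemma compact_norm_le (R : realType) (U : normedModType R) (K : set U) :
  compact K -> exists2 M : R, 0 <= M & forall x, K x -> `|x| <= M.
Proof.
move=> /compact_bounded[M [_ MK]]; exists (`|M| + 1); first exact: addr_ge0.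
by apply: MK; rewrite (le_lt_trans (ler_norm M))// ltrDl.
Qed.

Lemma bounded_by (R : realType) T (D : set T) (f : T -> R) (B : R) :
  (forall x, `|f x| <= B) -> [bounded f x | x in D].
Proof.
move=> fB; exists B; split=> [|M BM x _]; first exact: num_real.
exact: le_trans (fB x) (ltW BM).
Qed.

Lemma compact_margin (R : realType) (U : pseudoMetricType R) (K Om : set U) :
  compact K -> open Om -> K `<=` Om ->
  exists2 d : R, 0 < d & forall x, K x -> ball x d `<=` Om.
Proof.
move=> /compact_near_coveringP cK oOm KOm.
have := cK _ (0^'+ : set_system R) (fun e x => ball x e `<=` Om) _.
case=> [x Kx|e /= e0 eP].
  have /nbhs_ballP[e /= e0 eO] : nbhs x Om by apply: open_nbhs_nbhs; split=> //; exact: KOm.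
  have e20 : 0 < e / 2 by rewrite divr_gt0.
  exists (ball x (e / 2), [set h | h < e / 2]) => /=.
    by split; [exact: nbhsx_ballx|exact: nbhs_right_lt].
  move=> [y h] /= [yx he] z yz; apply: eO.
  rewrite (splitr e); apply: ball_triangle yx _.
  by apply: le_ball yz; exact: ltW.
exists (e / 2); first by rewrite divr_gt0.
apply: eP; last by rewrite divr_gt0.
by rewrite /= sub0r normrN gtr0_norm ?divr_gt0// gtr_pMr// invf_lt1 ?ltr1n.
Qed.

(** * Lipschitz functions of one variable *)

Section lipschitz_ae_derivable.
Context {R : realType}.
Local Notation leb := (@lebesgue_measure R).

(** The outer measure that defines the Lebesgue-Stieltjes measure is an infimum
    over covers by half-open intervals, and the bound holds on each of them. *)
Lemma lebesgue_stieltjes_le (F : cumulative R R) (C : R) (A : set R) : 0 < C ->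
  (forall x y, x <= y -> F y - F x <= C * (y - x)) ->
  (lebesgue_stieltjes_measure F A <= C%:E * leb A)%E.
Proof.
move=> C0 FC; rewrite /lebesgue_measure/= /lebesgue_stieltjes_measure.
rewrite /measure_extension /mu_ext -ereal_inf_pZl//.
apply: le_ereal_inf_tmp => _ [_ [G [mG AG] <-] <-].
apply: (@le_trans _ _ (\sum_(0 <= k <oo) wlength F (G k))%E).
  by apply: ereal_inf_lbound; exists G.
rewrite -nneseriesZl//; apply: lee_nneseries => // n _.
have [[a b] /= _ <-] := mG n.
have [ab|ba] := leP a b; last first.
  by rewrite set_itv_ge ?bnd_simp -?leNgt ?(ltW ba)// !wlength0 mule0.
by rewrite !wlength_itv_bnd// -EFinM lee_fin FC.
Qed.

Lemma lebesgue_stieltjes_itv (F : cumulative R R) (a b : R) : a <= b ->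
  lebesgue_stieltjes_measure F `]a, b]%classic = (F b - F a)%:E.
Proof.
move=> ab; rewrite /lebesgue_stieltjes_measure /measure_extension.
by rewrite measurable_mu_extE/= ?wlength_itv_bnd//; exact: is_ocitv.
Qed.

(** The Stieltjes measure of [F], restricted to [`]a, b]], is finite and, being
    at most [C] times the Lebesgue measure, has a density. So [F] is an indefinite
    integral on that interval, and Lebesgue's differentiation theorem applies. *)
Lemma cumulative_ae_derivable_itv (F : cumulative R R) (C a b : R) :
  0 < C -> (forall x y, x <= y -> F y - F x <= C * (y - x)) -> a < b ->
  {ae leb, forall x, a < x < b -> derivable F x 1}.
Proof.
move=> C0 FC ab.
have mD : measurable (`]a, b]%classic : set (measurableTypeR R)).
  exact: measurable_itv.
have nuoo : (lebesgue_stieltjes_measure F `]a, b]%classic < +oo)%E.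
  by rewrite lebesgue_stieltjes_itv ?ltW// ltry.
pose nu : {finite_measure set (measurableTypeR R) -> \bar R} := mfrestr mD nuoo.
have numu : nu `<< leb.
  move=> A A0 B mB BA.
  have B0 : leb B = 0 by exact: A0.
  apply/eqP; rewrite -measure_le0 /= /mfrestr /mrestr.
  apply: (@le_trans _ _ (C%:E * leb (B `&` `]a, b]%classic))%E).
    exact: lebesgue_stieltjes_le.
  rewrite (@subset_measure0 _ _ _ leb (B `&` `]a, b]%classic) B) ?mule0//.
  exact: measurableI.
have [f [f0 ffin intf nuE]] := radon_nikodym_sigma_finite numu.
pose g := fine \o f.
have gE : EFin \o g = f by apply/funext => x /=; rewrite fineK.
have ig (D : set R) : measurable D -> leb.-integrable D (EFin \o g).
  by move=> mD'; rewrite gE; exact: integrableS intf.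
have lg : locally_integrable [set: R] g.
  by apply: open_integrable_locally; [exact: openT|exact: ig].
have := @FTC1 R g (BRight a) (fun y => ig _ (measurable_itv _)) lg.
apply: filterS; first exact: (ae_filter_ringOfSetsType leb).
move=> x H /andP[ax xb].
have [dx _] := H ax.
have FE y : y \in `]a, b[ ->
    (\int[leb]_(t in `]a, y]) g t)%R + F a = F y.
  rewrite in_itv/= => /andP[ay yb].
  rewrite /Rintegral -[X in fine X]/(\int[leb]_(t in `]a, y]) (EFin \o g) t)%E.
  rewrite gE -nuE; last exact: measurable_itv.
  rewrite /= /mfrestr /mrestr setIidl; last first.
    by apply: subset_itvl; rewrite bnd_simp ltW.
  by rewrite lebesgue_stieltjes_itv ?ltW//= subrK.
apply: (@near_eq_derivable _ _ _
    (fun y => (\int[leb]_(t in `]a, y]) g t)%R + F a)).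
  have : x \in `]a, b[ by rewrite in_itv/= ax.
  by move=> /near_in_itvoo; apply: filterS => y; exact: FE.
exact: derivableD.
Qed.

(** Adding the linear function [L * x] to [g] makes it nondecreasing, hence the
    cumulative function of a measure. *)
Lemma lipschitz_ae_derivable (g : R -> R) (L : R) :
  (forall x y, `|g x - g y| <= L * `|x - y|) ->
  {ae leb, forall x, derivable g x 1}.
Proof.
move=> gL.
have L0 : 0 <= L.
  by have := le_trans (normr_ge0 _) (gL 1 0); rewrite subr0 normr1 mulr1.
pose G x : R := g x + L * x.
have GB x y : x <= y -> 0 <= G y - G x <= (2 * L + 1) * (y - x).
  move=> xy; have := gL y x.
  rewrite ler_norml (ger0_norm (_ : 0 <= y - x)) ?subr_ge0//.
  have : 0 <= y - x by rewrite subr_ge0.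
  by rewrite /G; nra.
have gc : continuous g := lipschitz_continuous gL.
have Gnd : {homo G : x y / x <= y}.
  by move=> x y /GB/andP[]; rewrite subr_ge0.
have Grc : right_continuous G.
  apply: right_continuousW => x; apply: cvgD; first exact: gc.
  by apply: cvgM; [exact: cvg_cst|exact: cvg_id].
pose mG := isCumulative.Build R _ R G Gnd Grc.
pose F : cumulative R R := HB.pack G mG.
have FC x y : x <= y -> F y - F x <= (2 * L + 1) * (y - x).
  by move=> /GB/andP[].
have C0 : 0 < 2 * L + 1 by lra.
have : {ae leb, forall x, forall n, - n%:R < x < n.+1%:R -> derivable F x 1}.
  apply: ae_foralln => n; apply: (cumulative_ae_derivable_itv C0 FC).
  by rewrite (le_lt_trans _ (ltr0Sn _ _))// oppr_le0.
apply: filterS; first exact: (ae_filter_ringOfSetsType leb).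
move=> x H.
have dG : derivable G x 1.
  apply: (H (Num.bound `|x|)).
  have := archi_boundP (normr_ge0 x); rewrite ltr_norml => /andP[-> xn] /=.
  by rewrite (lt_trans xn)// ltr_nat.
rewrite (_ : g = G - (L \*: id)); last first.
  by apply/funext => y; rewrite !fctE /= /G addrK.
by apply: derivableB => //; exact: derivableZ.
Qed.

End lipschitz_ae_derivable.

(** * Borel sets and Fubini's theorem in R^n *)

Section rV_borel.
Context {R : realType} {n : nat}.
Implicit Types (x y : 'rV[R]_n) (A U K : set 'rV[R]_n).

Lemma measurable_box (A : 'I_n -> set R) : (forall i, measurable (A i)) ->
  measurable [set x : 'rV[R]_n | forall i, A i (x ord0 i)].
Proof.
move=> mA; rewrite (_ : mkset _ = \bigcap_(i in [set: 'I_n])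
    ((fun y : 'rV_n => y ord0 i) @^-1` A i)).
  apply: fin_bigcap_measurable => [|i _]; first exact: finite_finset.
  by rewrite -[_ @^-1` _]setTI; apply: measurable_coord.
by apply/seteqP; split=> [y Ay i _|y Ay i]; exact: Ay.
Qed.

Let rat_box (p : 'rV[rat]_n * nat) : set 'rV[R]_n :=
  [set y | forall i, ball (ratr (p.1 ord0 i) : R) p.2.+1%:R^-1 (y ord0 i)].

Let measurable_rat_box p : measurable (rat_box p).
Proof.
apply: (measurable_box (A := fun i => ball (ratr (p.1 ord0 i) : R) p.2.+1%:R^-1)).
by move=> i; rewrite ball_itv; exact: measurable_itv.
Qed.

(** [U] is the union of the rational boxes that it contains. *)
Lemma open_measurable_rV U : open U -> measurable U.
Proof.
move=> oU.
pose F p := if pselect (rat_box p `<=` U) then rat_box p else set0.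
rewrite (_ : U = \bigcup_p F p).
  apply: countable_bigcupT_measurable => [|p]; first exact: countableP.
  rewrite /F; case: pselect => _ /=.
    exact: measurable_rat_box.
  exact: measurable0.
apply/seteqP; split=> [x Ux|x [p _]]; last first.
  by rewrite /F; case: pselect => [pU /pU|].
have /nbhs_ballP[e /= e0 eU] : nbhs x U by exact: open_nbhs_nbhs.
have [k ke] : exists k : nat, k.+1%:R^-1 < e / 2.
  by apply: natSinv_lt; rewrite divr_gt0.
have k0 : 0 < k.+1%:R^-1 :> R by rewrite invr_gt0.
have /choice[q qx] i : exists q : rat, ball (x ord0 i) k.+1%:R^-1 (ratr q : R).
  exact: (nbhs_rat (nbhsx_ballx _ _ k0)).
exists (\row_i q i, k) => //.
rewrite /F; case: pselect => [_ i|/=]; first by rewrite mxE; exact: ball_sym.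
case=> y yq; apply: eU; split=> // i j; rewrite ord1 (splitr e).
apply: (@ball_triangle _ _ (ratr (q j) : R)).
  exact: (le_ball (ltW ke) (qx j)).
by apply: (le_ball (ltW ke)); have := yq j; rewrite mxE.
Qed.

Lemma closed_measurable_rV A : closed A -> measurable A.
Proof. by move/closed_openC/open_measurable_rV/measurableC; rewrite setCK. Qed.

Lemma compact_measurable_rV K : compact K -> measurable K.
Proof.
move=> cK; apply: closed_measurable_rV.
have hV : hausdorff_space 'rV[R]_n by exact: (@norm_hausdorff _ 'rV[R]_n).
exact: compact_closed.
Qed.

Lemma continuous_measurable_rV (f : 'rV[R]_n -> R) :
  continuous f -> measurable_fun setT f.
Proof.
move=> /continuousP cf; apply: (measurability _ (RGenOpens.measurableE R)).
move=> _ [_ [a [b ->] <-]]; rewrite setTI; apply: open_measurable_rV.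
exact/cf/interval_open.
Qed.

Lemma compact_finite_measure K :
  compact K -> (@lebesgue_measure_rV R n K < +oo)%E.
Proof.
move=> cK; have [r _ Kr] := compact_norm_le cK.
pose A (i : 'I_n) : set R := `[- r, r]%classic.
have mA i : measurable (A i) by exact: measurable_itv.
have := lebesgue_measure_rV_box mA; set B := [set x | _] => BE.
apply: (@le_lt_trans _ _ (lebesgue_measure_rV B)).
  apply: le_measure; rewrite ?inE.
  - exact: compact_measurable_rV.
  - exact: measurable_box.
  move=> x /Kr xr i; rewrite /A/= in_itv/= -ler_norml (le_trans _ xr)//.
  rewrite [leRHS]mx_normrE.
  exact: (@le_bigmax _ _ _ 0 (fun ij => `|x ij.1 ij.2|) (ord0, i)).
have : (\prod_(i < n) @lebesgue_measure R (A i))%E \is a fin_num.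
  apply: prode_fin_num => i _; rewrite /A lebesgue_measure_itv/=.
  by case: ifPn.
by rewrite BE fin_numElt => /andP[].
Qed.

End rV_borel.

Section row_cons_lines.
Context {R : realType} {n : nat}.
Implicit Types (t s : R) (y : 'rV[R]_n).

Lemma row_consE0 t y : row_cons (t, y) ord0 ord0 = t.
Proof.
by rewrite -[RHS](row_consEl (t, y) ord0); congr (_ _ _); exact: val_inj.
Qed.

Lemma row_consES t y j : row_cons (t, y) ord0 (lift ord0 j) = y ord0 j.
Proof.
by rewrite -[RHS](row_consEr (t, y) j); congr (_ _ _); exact: val_inj.
Qed.

Lemma row_cons_line0 t y :
  row_cons (t, y) = row_cons (0 : R, y) + t *: delta_mx ord0 ord0.
Proof.
apply/rowP => i; rewrite [RHS]mxE; case: (unliftP ord0 i) => [j|] ->.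
  rewrite !row_consES !mxE (eq_sym (lift _ _)) (negbTE (neq_lift _ _)).
  by rewrite andbF mulr0 addr0.
by rewrite !row_consE0 !mxE !eqxx mulr1 add0r.
Qed.

Lemma row_cons_lineS t y j s : row_cons (t, y + s *: delta_mx ord0 j) =
  row_cons (t, y) + s *: delta_mx ord0 (lift ord0 j).
Proof.
apply/rowP => i; rewrite [RHS]mxE; case: (unliftP ord0 i) => [k|] ->.
  by rewrite !row_consES !mxE !eqxx/= (inj_eq (@lift_inj _ _)).
by rewrite !row_consE0 !mxE (negbTE (neq_lift _ _)) andbF mulr0 addr0.
Qed.

End row_cons_lines.

(** Fubini's theorem along an axis. The measure of R^n.+1 integrates out the
    coordinate 0 first or last; a line in the direction [i > 0] lies in a slice
    on which the induction hypothesis applies. *)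
Lemma null_lines (R : realType) n (i : 'I_n) (A : set 'rV[R]_n) : measurable A ->
  (forall x, @lebesgue_measure R
     [set t : R | A (x + t *: delta_mx ord0 i)] = 0) ->
  lebesgue_measure_rV A = 0.
Proof.
elim: n i A => [[//]|n IHn] i A mA A0.
have mA' : measurable (@row_cons R n @^-1` A).
  by rewrite -[_ @^-1` _]setTI; exact: measurable_row_cons.
rewrite /= /lebesgue_measure_rVS /pushforward.
case: (unliftP ord0 i) A0 => [j|] -> A0.
  rewrite /product_measure1 integral0_eq// => t _ /=.
  apply: (IHn j); first exact: measurable_xsection.
  move=> y; rewrite -[RHS](A0 (row_cons (t, y))); congr lebesgue_measure.
  by apply/seteqP; split=> s /=; rewrite /xsection/= inE/= row_cons_lineS.
(* integrate over the coordinate 0 first, i.e. in the other order *)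
rewrite (product_measure_unique
    (m' := (@lebesgue_measure R \x^ @lebesgue_measure_rV R n)%E))
  => [|B C mB mC|//].
  rewrite /= /product_measure2 integral0_eq// => y _ /=.
  rewrite -[RHS](A0 (row_cons (0 : R, y))); congr lebesgue_measure.
  by apply/seteqP; split=> s /=; rewrite /ysection/= inE/= (row_cons_line0 s).
exact: (product_measure2E (@lebesgue_measure R) (@lebesgue_measure_rV R n)).
Qed.

(** * Directional derivatives *)

Section directional_derivative.
Context {R : realType} {n : nat}.
Implicit Types (f : 'rV[R]_n -> R) (x v : 'rV[R]_n).

Definition diff_quot f v (h : R) x : R := h^-1 * (f (h *: v + x) - f x).

Definition derivable_set f v : set 'rV[R]_n :=
  [set x | derivable (f : 'rV[R]_n -> R^o) x v].

Lemma derivableE f x v : derivable (f : 'rV[R]_n -> R^o) x v <->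
  cvg (diff_quot f v h x @[h --> 0^']).
Proof. by []. Qed.

Lemma deriveE f x v :
  'D_v (f : 'rV[R]_n -> R^o) x = lim (diff_quot f v h x @[h --> 0^']).
Proof. by []. Qed.

Lemma derive_dvg f x v :
  ~ derivable_set f v x -> 'D_v (f : 'rV[R]_n -> R^o) x = 0.
Proof. by move=> dvg; rewrite deriveE dvgP. Qed.

Lemma cvg_diff_quot T (F : set_system T) (FF : Filter F) (y : T -> 'rV[R]_n)
    f v h x : continuous f -> y t @[t --> F] --> x ->
  diff_quot f v h (y t) @[t --> F] --> diff_quot f v h x.
Proof.
move=> cf yx; apply: cvgM; first exact: cvg_cst.
apply: cvgB; last exact: (cvg_comp _ _ yx (cf x)).
apply: (cvg_comp (fun t => h *: v + y t) f _ (cf _)).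
by apply: cvgD => //; exact: cvg_cst.
Qed.

Lemma diff_quot_continuous f v h : continuous f -> continuous (diff_quot f v h).
Proof.
by move=> cf x; exact: (@cvg_diff_quot _ (nbhs x) (nbhs_filter x) id).
Qed.

Lemma diff_quot_continuous_step f v x (h : R) : continuous f -> h != 0 ->
  {for h, continuous (diff_quot f v ^~ x)}.
Proof.
move=> cf h0; apply: cvgM; first exact: cvgV.
apply: cvgB; last exact: cvg_cst.
apply: (cvg_comp (fun t : R => t *: v + x) f _ (cf _)).
by apply: cvgD; [apply: cvgZr_tmp; exact: cvg_id|exact: cvg_cst].
Qed.

(** Steps and tentative limits range over the rationals, which makes
    [derivable_set] a countable combination of closed sets. *)
Let near_rat f v (k m : nat) (c : rat) : set 'rV[R]_n :=
  [set x | forall a : rat, 0 < `|ratr a : R| < m.+1%:R^-1 ->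
    `|diff_quot f v (ratr a) x - ratr c| <= k.+1%:R^-1].

(** By completeness the difference quotients converge iff, up to any given
    error, they are constant for all small steps; as they depend continuously on
    the step, rational steps suffice. *)
Lemma derivable_setE f v : continuous f -> derivable_set f v =
  \bigcap_k \bigcup_mc near_rat f v k mc.1 mc.2.
Proof.
move=> cf; apply/seteqP; split=> [x /derivableE/cvg_ex[l /= xl] k _|x xk].
  have k0 : 0 < k.+1%:R^-1 / 2 :> R by rewrite divr_gt0.
  rewrite /near_rat/=; set d : R := k.+1%:R^-1 in k0 *.
  have [c] := @rat_in_itvoo R (l - d / 2) l ltac:(by rewrite ltrBlDr ltrDl).
  rewrite in_itv/= => /andP[cl lc].
  move/cvgrPdist_lt : xl => /(_ _ k0).
  rewrite /dnbhs /within/= => /nbhs_ballP[e /= e0 xe].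
  have [m me] := natSinv_lt e0.
  exists (m, c) => //= a /= /andP[a0 am].
  have := xe (ratr a); rewrite /ball/= sub0r normrN.
  move=> /(_ (lt_trans am me)); rewrite -normr_gt0 => /(_ a0).
  rewrite ltr_distlC => /andP[? ?]; rewrite ler_distlC; lra.
apply/derivableE/cauchy_cvgP/cauchy_exP => e /= e0.
have [k ke] := natSinv_lt e0.
have [[m c] _ xkm] := xk k Logic.I.
exists (ratr c : R); rewrite /fmap/=.
have m0 : 0 < m.+1%:R^-1 :> R by rewrite invr_gt0.
have : \forall h \near (0 : R)^', h != 0 by exact: nbhs_dnbhs_neq.
apply: filterS2 (dnbhs0_lt m0) => h hm h0; rewrite /ball/= distrC.
apply: le_lt_trans ke; rewrite leNgt; apply/negP => kh.
have kh' : \forall t \near h, k.+1%:R^-1 < `|diff_quot f v t x - ratr c|.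
  have : `|diff_quot f v t x - ratr c| @[t --> h] -->
      `|diff_quot f v h x - ratr c|.
    apply: cvg_norm; apply: cvgB; last exact: cvg_cst.
    exact: diff_quot_continuous_step.
  by move=> /cvgr_gt/(_ _ kh).
have hm' : \forall t \near h, `|t| < m.+1%:R^-1.
  by have /cvgr_lt/(_ _ hm) := @norm_continuous _ _ h.
have h0' : \forall t \near h, 0 < `|t|.
  by have /cvgr_gt := @norm_continuous _ _ h; apply; rewrite normr_gt0.
have [a [[a1 a2] a3]] := nbhs_rat (filterI (filterI kh' hm') h0').
by move: a1; rewrite ltNge => /negP; apply; apply: xkm; rewrite a2 a3.
Qed.

Lemma measurable_derivable_set f v :
  continuous f -> measurable (derivable_set f v).
Proof.
move=> cf; rewrite derivable_setE//; apply: bigcapT_measurable => k.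
apply: countable_bigcupT_measurable => [|[m c]]; first exact: countableP.
rewrite (_ : near_rat _ _ _ _ _ = \bigcap_a
  [set x | 0 < `|ratr a : R| < m.+1%:R^-1 ->
    `|diff_quot f v (ratr a) x - ratr c| <= k.+1%:R^-1]); last first.
  by apply/seteqP; split=> [x xP a _|x xP a]; [exact: xP|exact: xP a Logic.I].
rewrite -[X in measurable X]setCK setC_bigcap; apply: measurableC.
apply: countable_bigcupT_measurable => [|a]; first exact: countableP.
apply: measurableC.
have [a0|a0] := boolP (0 < `|ratr a : R| < m.+1%:R^-1); last first.
  by rewrite (_ : mkset _ = setT)//; apply/seteqP; split.
rewrite (_ : mkset _ = (fun x => `|diff_quot f v (ratr a) x - ratr c|) @^-1`
    `]-oo, k.+1%:R^-1]%classic); last first.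
  by apply/seteqP; split=> [x /(_ isT)|x + _]; rewrite /= in_itv.
rewrite -[_ @^-1` _]setTI; apply: continuous_measurable_rV => // x.
apply: (@continuous_comp _ _ _ (diff_quot f v (ratr a))
  (fun y => `|y - ratr c|)).
  exact: diff_quot_continuous.
by apply: cvg_norm; apply: cvgB; [exact: cvg_id|exact: cvg_cst].
Qed.

Lemma measurable_derive f v : continuous f ->
  measurable_fun setT (fun x => 'D_v (f : 'rV[R]_n -> R^o) x).
Proof.
move=> cf; have mD := measurable_derivable_set v cf.
rewrite -(setUv (derivable_set f v)); apply/measurable_funU => //.
  exact: measurableC.
split; last first.
  apply: (eq_measurable_fun (cst (0 : R))) => [x|]; last exact: measurable_cst.
  by rewrite inE => /derive_dvg ->.
apply: (@measurable_fun_cvg _ _ _ _ (fun k => diff_quot f v k.+1%:R^-1)).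
  move=> k; apply: measurable_funTS; apply: continuous_measurable_rV.
  exact: diff_quot_continuous.
move=> x /derivableE xD; rewrite deriveE.
have /cvgr_dnbhsP := xD; apply; split=> [k|]; first by rewrite gt_eqF.
exact: cvg_harmonic.
Qed.

(** On each line parallel to the axis [i] this is the one-dimensional theorem. *)
Lemma negligible_not_derivable f (i : 'I_n) (L : R) :
  (forall x y, `|f x - f y| <= L * `|x - y|) ->
  @lebesgue_measure_rV R n (~` derivable_set f (delta_mx ord0 i)) = 0.
Proof.
move=> fL; set v := delta_mx _ _.
have cf : continuous f := lipschitz_continuous fL.
have mD : measurable (~` derivable_set f v).
  by apply: measurableC; exact: measurable_derivable_set.
apply: (null_lines (i := i)) => // x.
pose g t := f (x + t *: v).
have gL s t : `|g s - g t| <= (L * `|v|) * `|s - t|.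
  apply: (le_trans (fL _ _)).
  by rewrite opprD addrACA subrr add0r -scalerBl normrZ mulrA mulrAC.
have gf t : derivable g t 1 -> derivable_set f v (x + t *: v).
  rewrite /derivable_set/= /derivable.
  rewrite (_ : (fun h => _) = (fun h : R =>
    h^-1 *: ((f \o shift (x + t *: v)) (h *: v) - f (x + t *: v))))//.
  apply/funext => h; rewrite /= /g (_ : h *: 1 = h); last exact: mulr1.
  by rewrite scalerDl addrCA.
have mS : measurable
    ([set t | (~` derivable_set f v) (x + t *: v)] : set (measurableTypeR R)).
  rewrite -[X in measurable X]setTI.
  apply: (@measurable_fun_rV R n _ _ (fun t : R => x + t *: v)) => // j.
  rewrite (_ : (fun _ => _) = fun t : R => x ord0 j + t * v ord0 j); last first.
    by apply/funext => t; rewrite !mxE.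
  apply: continuous_measurable_fun => t.
  apply: cvgD; first exact: cvg_cst.
  by apply: cvgMr_tmp; exact: cvg_id.
apply: (measure_negligible mS).
have := lipschitz_ae_derivable gL.
apply: negligibleS => t /= + dg; apply; exact: gf.
Qed.

End directional_derivative.

Section directional_derivative_bounds.
Context {R : realType} {n : nat}.
Implicit Types (f : 'rV[R]_n -> R) (x v : 'rV[R]_n).

Lemma derive_cvg f v x : derivable_set f v x ->
  diff_quot f v h x @[h --> 0^'] --> 'D_v (f : 'rV[R]_n -> R^o) x.
Proof. by []. Qed.

Lemma derive_lipschitz_le f v x (L : R) :
  (forall x y, `|f x - f y| <= L * `|x - y|) ->
  `|'D_v (f : 'rV[R]_n -> R^o) x| <= L * `|v|.
Proof.
move=> fL.
have [xD|/derive_dvg ->] := pselect (derivable_set f v x); last first.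
  by rewrite normr0; have := fL v 0; rewrite subr0; exact: le_trans.
have /cvg_norm qn := derive_cvg xD.
rewrite -(cvg_lim _ qn)//; apply: limr_le.
  by apply/cvg_ex; eexists; exact: qn.
have : \forall h \near (0 : R)^', h != 0 by exact: nbhs_dnbhs_neq.
apply: filterS => h h0.
rewrite /diff_quot normrM normfV mulrC ler_pdivrMr ?normr_gt0//.
by rewrite (le_trans (fL _ _))// addrK normrZ mulrAC mulrA.
Qed.

Lemma derive_supp0 f v x : ~ supp f x -> 'D_v (f : 'rV[R]_n -> R^o) x = 0.
Proof.
move=> xf; rewrite (@near_eq_derive _ _ _ _ (cst 0)); first exact: derive_cst.
have : \forall y \near x, (~` supp f) y.
  by apply: open_nbhs_nbhs; split=> //; apply: closed_openC; exact: closed_closure.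
apply: filterS => y fy; apply: contrapT => /eqP fy0; apply: fy.
exact: subset_closure.
Qed.

(** Where [f x != 0], [|f|] is [f] or [- f] near [x]. Where [f x = 0], [x]
    minimizes [|f|], so the derivative of [|f|] is 0 if it exists; and it is 0 by
    convention if it does not. *)
Lemma derive_norm_le f v x : continuous f ->
  'D_v ((fun y => `|f y|) : 'rV[R]_n -> R^o) x ^+ 2 <=
  'D_v (f : 'rV[R]_n -> R^o) x ^+ 2.
Proof.
move=> cf.
have [fx0|fx0|fx0] := ltgtP (f x) 0.
- rewrite (@near_eq_derive _ _ _ _ (- (f : 'rV[R]_n -> R^o))); last first.
    have /cvgr_lt/(_ _ fx0) := cf x.
    by apply: filterS => y fy; rewrite ltr0_norm.
  have [xD|xD] := pselect (derivable_set f v x).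
    by rewrite deriveN// sqrrN.
  rewrite (@derive_dvg _ _ (- f)) ?expr0n ?sqr_ge0//.
  by move=> /derivableN; rewrite opprK.
- rewrite (@near_eq_derive _ _ _ _ (f : 'rV[R]_n -> R^o))//.
  have /cvgr_gt/(_ _ fx0) := cf x.
  by apply: filterS => y fy; rewrite gtr0_norm.
have [xD|/derive_dvg ->] := pselect (derivable_set (fun y => `|f y|) v x);
    last first.
  by rewrite expr0n sqr_ge0.
suff -> : 'D_v ((fun y => `|f y|) : 'rV[R]_n -> R^o) x = 0.
  by rewrite expr0n sqr_ge0.
have qD := derive_cvg xD.
have fx :
  diff_quot (fun y => `|f y|) v ^~ x = fun h => h^-1 * `|f (h *: v + x)|.
  by apply/funext => h; rewrite /diff_quot fx0 normr0 subr0.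
rewrite fx in qD; apply/eqP; rewrite eq_le; apply/andP; split.
  have ql := cvg_dnbhs_at_left qD; rewrite -(cvg_lim _ ql)//.
  apply: limr_le; first by apply/cvg_ex; eexists; exact: ql.
  apply: filterS (nbhs_left_lt 0) => h h0.
  by rewrite mulr_le0_ge0// invr_le0 ltW.
have qr := cvg_dnbhs_at_right qD; rewrite -(cvg_lim _ qr)//.
apply: limr_ge; first by apply/cvg_ex; eexists; exact: qr.
by apply: filterS (nbhs_right_gt 0) => h h0; rewrite mulr_ge0// invr_ge0 ltW.
Qed.

End directional_derivative_bounds.

(** * Regularity of test functions *)

Section test_functions_regularity.
Context {R : realType} {N : nat} {Om : set 'rV[R]_N}.
Hypothesis oOm : open Om.
Implicit Types xi : test_fun Om.

Lemma test_fun_props xi : [/\ [lipschitz (xi x : R^o) | x in Om],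
  compact (supp xi) & supp xi `<=` Om].
Proof. by case: xi => f /=; rewrite inE. Qed.

Lemma supp_neq0 (f : 'rV[R]_N -> R) x : f x != 0 -> supp f x.
Proof. by move=> fx; exact: subset_closure. Qed.

Lemma supp_eq0 (f : 'rV[R]_N -> R) x : ~ supp f x -> f x = 0.
Proof. by move=> fx; apply: contrapT => /eqP/supp_neq0. Qed.

(** Off [Om] the function is 0, and the support stays at a distance [d] from the
    complement of [Om]; so a pair with one point outside contributes at most
    the slope [B / d]. *)
Lemma test_fun_lipschitzT xi :
  exists L, forall x y, `|xi x - xi y| <= L * `|x - y|.
Proof.
have [[M [_ xiM]] cK KOm] := test_fun_props xi.
set K := supp xi in cK KOm.
have {}xiM x y : Om x -> Om y -> `|xi x - xi y| <= (`|M| + 1) * `|x - y|.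
  move=> Ox Oy; apply: (xiM _ _ (x, y)) => //.
  by rewrite (le_lt_trans (ler_norm M))// ltrDl.
set L := `|M| + 1 in xiM.
have L0 : 0 < L by rewrite /L ltr_wpDl.
have [[x0 Kx0]|K0] := pselect (K !=set0); last first.
  have xi0 x : xi x = 0.
    by apply: contrapT => /eqP xx; apply: K0; exists x; exact: supp_neq0.
  by exists 0 => x y; rewrite !xi0 subrr normr0 mul0r.
have [r r0 Kr] := compact_norm_le cK.
(* B bounds xi: both x0 and x lie in the ball of radius r, so |x - x0| <= r + r *)
pose B := `|xi x0| + L * (r + r).
have xiB x : K x -> `|xi x| <= B.
  move=> Kx; rewrite -(subrK (xi x0) (xi x)).
  rewrite (le_trans (ler_normD _ _))// addrC lerD2l.
  rewrite (le_trans (xiM _ _ (KOm _ Kx) (KOm _ Kx0)))// ler_pM2l//.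
  by rewrite (le_trans (ler_normB _ _))// lerD// Kr.
have [d d0 Kd] := compact_margin cK oOm KOm.
have B0 : 0 <= B.
  by rewrite /B addr_ge0// mulr_ge0 ?(ltW L0)// addr_ge0.
exists (L + B / d) => x y.
wlog Kx : x y / K x.
  move=> H; have [/H//|Kx] := pselect (K x).
  have [Ky|Ky] := pselect (K y).
    by rewrite distrC [X in _ * X]distrC; exact: H.
  rewrite (supp_eq0 Kx) (supp_eq0 Ky) subrr normr0.
  by rewrite mulr_ge0// addr_ge0 ?divr_ge0 ?(ltW L0) ?(ltW d0).
have [Oy|Oy] := pselect (Om y).
  rewrite (le_trans (xiM _ _ (KOm _ Kx) Oy))// ler_wpM2r//.
  by rewrite lerDl divr_ge0// ltW.
rewrite [xi y]supp_eq0; last by move/KOm.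
rewrite subr0 (le_trans (xiB _ Kx))//.
have dxy : d <= `|x - y|.
  rewrite leNgt; apply/negP => xyd; apply: Oy; apply: (Kd _ Kx).
  by rewrite -ball_normE.
rewrite -[leLHS](divfK (lt0r_neq0 d0)).
have : 0 <= B / d by rewrite divr_ge0// ltW.
by nra.
Qed.

Lemma test_fun_continuous xi : continuous xi.
Proof. by have [L /lipschitz_continuous] := test_fun_lipschitzT xi. Qed.

Lemma measurable_test_fun xi : measurable_fun setT xi.
Proof.
by apply: continuous_measurable_rV; exact: test_fun_continuous.
Qed.

Lemma test_fun_bounded xi : exists B, forall x, `|xi x| <= B.
Proof.
have [_ cK _] := test_fun_props xi.
have cxi : {within supp xi, continuous xi}.
  by apply: continuous_subspaceT; exact: test_fun_continuous.
have [M M0 KM] := compact_norm_le (continuous_compact cxi cK).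
exists M => x; have [Kx|/supp_eq0 ->] := pselect (supp xi x).
  by apply: KM; exists x.
by rewrite normr0.
Qed.

Lemma measurable_partial xi i : measurable_fun setT (partial i xi).
Proof.
by apply: measurable_derive; exact: test_fun_continuous.
Qed.

Lemma partial_bounded xi i : exists B, forall x, `|partial i xi x| <= B.
Proof.
have [L xiL] := test_fun_lipschitzT xi.
by exists (L * `|delta_mx ord0 i : 'rV[R]_N|) => x; exact: derive_lipschitz_le.
Qed.

Lemma partial_eq0 xi i x : ~ supp xi x -> partial i xi x = 0.
Proof. exact: derive_supp0. Qed.

Lemma partialD_ae (xi phi : test_fun Om) (a : R) :
  {ae @lebesgue_measure_rV R N, forall x, forall i,
    partial i (a *: xi + phi) x = a * partial i xi x + partial i phi x}.
Proof.
pose D (f : test_fun Om) i := derivable_set f (delta_mx ord0 i).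
have aeD f i : \forall x \ae (@lebesgue_measure_rV R N), D f i x.
  have [L fL] := test_fun_lipschitzT f.
  have nD := negligible_not_derivable i fL.
  exists (~` D f i); split=> //.
  apply: measurableC; apply: measurable_derivable_set; exact: test_fun_continuous.
have : \forall x \ae (@lebesgue_measure_rV R N), forall i, D xi i x /\ D phi i x.
  by apply: filter_forall => i; apply: filterI; exact: aeD.
apply: filterS => x xD i; have [xix phix] := xD i.
rewrite /partial deriveD//; last exact: derivableZ.
by rewrite deriveZ.
Qed.

End test_functions_regularity.

(** * The energy form *)

Lemma integrable_support d (T : measurableType d) (R : realType)
    (mu : {measure set T -> \bar R}) (K D : set T) (f : T -> R) :
  measurable K -> measurable D -> K `<=` D -> (forall x, ~ K x -> f x = 0) ->
  mu.-integrable K (EFin \o f) -> mu.-integrable D (EFin \o f).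
Proof.
move=> mK mD KD f0 /integrable_mkcond fK; apply/integrable_mkcond => //.
rewrite (_ : _ \_ D = (EFin \o f) \_ K); first exact: fK.
apply/funext => x; rewrite !patchE; case: ifPn => [xD|/negP xD]; last first.
  by rewrite ifN//; apply/negP; rewrite !inE in xD * => /KD.
by case: ifPn => // /negP; rewrite inE /= => /f0 ->.
Qed.

Lemma integrableD_EFin d (T : measurableType d) (R : realType)
    (mu : {measure set T -> \bar R}) (D : set T) (f g : T -> R) : measurable D ->
  mu.-integrable D (EFin \o f) -> mu.-integrable D (EFin \o g) ->
  mu.-integrable D (EFin \o (fun x => f x + g x)).
Proof. by move=> mD fD gD; have H := integrableD mD fD gD; exact: H. Qed.

Lemma integrableZl_EFin d (T : measurableType d) (R : realType)
    (mu : {measure set T -> \bar R}) (D : set T) (a : R) (f : T -> R) :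
  measurable D -> mu.-integrable D (EFin \o f) ->
  mu.-integrable D (EFin \o (fun x => a * f x)).
Proof. by move=> mD fD; have H := integrableZl mD a fD; exact: H. Qed.

Section energy_form.
Context {R : realType} {N : nat} {Om : set 'rV[R]_N} {V : 'rV[R]_N -> R}.
Hypotheses (oOm : open Om) (VOm : L1loc Om V).
Implicit Types xi phi : test_fun Om.
Local Notation mu := (@lebesgue_measure_rV R N).

Lemma measurable_supp xi : measurable (supp xi).
Proof. by have [_ cK _] := test_fun_props xi; exact: compact_measurable_rV. Qed.

Lemma integrable_test_mul (f : 'rV[R]_N -> R) xi :
  L1loc Om f -> mu.-integrable Om (EFin \o (fun x => f x * xi x)).
Proof.
move=> [mf fK]; have [_ cK KOm] := test_fun_props xi.
apply: (@integrable_support _ _ _ _ (supp xi)) => //.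
- exact: measurable_supp.
- exact: open_measurable_rV.
- by move=> x /supp_eq0 ->; rewrite mulr0.
apply: (integrableMl (measurable_supp xi) (fK _ cK KOm)).
  by apply: measurable_funTS; exact: measurable_test_fun.
have [B xB] := test_fun_bounded oOm xi.
exact: bounded_by xB.
Qed.

Lemma L1loc_test_mul xi : L1loc Om (fun x => V x * xi x).
Proof.
have [mV VK] := VOm; split.
  apply: measurable_funM => //.
  by apply: measurable_funTS; exact: measurable_test_fun.
move=> K cK KOm; apply: integrableS (integrable_test_mul xi VOm) => //.
  exact: open_measurable_rV.
exact: compact_measurable_rV.
Qed.

Lemma integrable_energy xi phi : mu.-integrable Om (EFin \o (fun x =>
  (\sum_(i < N) partial i xi x * partial i phi x) + V x * xi x * phi x)).
Proof.
have [_ cK KOm] := test_fun_props xi.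
apply: (integrableD_EFin (open_measurable_rV oOm)); last first.
  exact: integrable_test_mul (L1loc_test_mul xi).
apply: (@integrable_support _ _ _ _ (supp xi)) => //.
- exact: measurable_supp.
- exact: open_measurable_rV.
- by move=> x Kx; rewrite big1// => i _; rewrite partial_eq0// mul0r.
apply: measurable_bounded_integrable.
- exact: measurable_supp.
- exact: compact_finite_measure.
- apply: measurable_sum => i; apply: measurable_funM;
    apply: measurable_funTS; exact: measurable_partial.
have /choice[B1 xB1] := partial_bounded oOm xi.
have /choice[B2 xB2] := partial_bounded oOm phi.
apply: (@bounded_by _ _ _ _ (\sum_i B1 i * B2 i)) => x.
rewrite (le_trans (ler_norm_sum _ _ _))// ler_sum// => i _.
by rewrite normrM ler_pM.
Qed.

Lemma energyC xi phi : energy V xi phi = energy V phi xi.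
Proof.
apply: eq_Rintegral => x _; congr (_ + _); last by rewrite mulrAC.
by apply: eq_bigr => i _; rewrite mulrC.
Qed.

(** The integrands agree wherever the partial derivatives of [xi] and [psi] all
    exist, which is almost everywhere. *)
Lemma energy_linear (a : R) xi psi phi :
  energy V (a *: xi + psi) phi = a * energy V xi phi + energy V psi phi.
Proof.
rewrite /energy -RintegralZl//; [|exact: open_measurable_rV|exact: integrable_energy].
rewrite -RintegralD//; [|exact: open_measurable_rV| |exact: integrable_energy]; last first.
  by apply: (integrableZl_EFin _ (open_measurable_rV oOm)); exact: integrable_energy.
rewrite /Rintegral; congr fine; apply: ae_eq_integral.
- exact: open_measurable_rV.
- exact: measurable_int (integrable_energy _ _).
- apply: (measurable_int mu).
  apply: (integrableD_EFin (open_measurable_rV oOm)); last exact: integrable_energy.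
  by apply: (integrableZl_EFin _ (open_measurable_rV oOm)); exact: integrable_energy.
have := partialD_ae oOm xi psi a.
apply: filterS => x xD Ox; congr EFin.
rewrite [RHS](_ : _ = \sum_(i < N) (a * (partial i xi x * partial i phi x) +
  partial i psi x * partial i phi x) +
  (a * (V x * xi x * phi x) + V x * psi x * phi x)).
  congr (_ + _).
    by apply: eq_bigr => i _; rewrite xD; ring.
  by rewrite /= !fctE /GRing.scale/=; ring.
by rewrite big_split/= -mulr_sumr; ring.
Qed.

Lemma energyDl xi psi phi :
  energy V (xi + psi) phi = energy V xi phi + energy V psi phi.
Proof. by rewrite -[xi in LHS]scale1r energy_linear mul1r. Qed.

Lemma energyZl (a : R) xi phi : energy V (a *: xi) phi = a * energy V xi phi.
Proof.
rewrite -[a *: xi]addr0 energy_linear -[X in _ + X](addrK (energy V 0 phi)).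
by rewrite -energyDl addr0 subrr addr0.
Qed.

Lemma test_fun_norm_lipc xi : (fun x => `|xi x|) \in lipc Om.
Proof.
have [[M [rM xiM]] cK KOm] := test_fun_props xi.
have suppE : supp (fun x => `|xi x|) = supp xi.
  by congr closure; apply/seteqP; split=> x /=; rewrite normr_eq0.
rewrite inE/=; split; rewrite ?suppE//.
exists M; split=> // M' MM' xy xyO; apply: le_trans (xiM _ MM' _ xyO).
exact: ler_dist_dist.
Qed.

Definition test_fun_norm xi : test_fun Om := TestFun (test_fun_norm_lipc xi).

Lemma Q_norm_le xi : Q V (test_fun_norm xi) <= Q V xi.
Proof.
rewrite -!energyE; apply: le_Rintegral.
- exact: open_measurable_rV.
- exact: integrable_energy.
- exact: integrable_energy.
move=> x _; apply: lerD.
  apply: ler_sum => i _; rewrite -!expr2.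
  by apply: derive_norm_le; exact: test_fun_continuous.
by rewrite -!mulrA -!expr2 /= real_normK ?num_real.
Qed.

End energy_form.

(** * Riesz representation in the completion *)

Section riesz_completion.
Context {R : realType} {E : lmodType R}.
Variable ip : E -> E -> R.
Hypothesis ipC : forall x y, ip x y = ip y x.
Hypothesis ipDl : forall x y z, ip (x + y) z = ip x z + ip y z.
Hypothesis ipZl : forall (a : R) x z, ip (a *: x) z = a * ip x z.
Hypothesis ip_ge0 : forall x, 0 <= ip x x.
Implicit Types (u v : nat -> E) (x y z : E).

Let ipDr x y z : ip x (y + z) = ip x y + ip x z.
Proof. by rewrite ipC ipDl !(ipC x). Qed.

Let ipZr a x z : ip x (a *: z) = a * ip x z.
Proof. by rewrite ipC ipZl ipC. Qed.

Lemma completion_ip_cvg (ip00 : ip 0 0 = 0) (C : completion ip) u x :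
  ip_cauchy ip u -> sval C = ip_class ip u ->
  completion_ip C (to_completion ip00 x) = limn (fun n => ip (u n) x).
Proof.
move=> cu Cu.
by rewrite (completion_ipE ipC ipDl ipZl ip_ge0 cu (ip_cauchy_cst ip00 x)).
Qed.

Variables (l : E -> R) (c : R).
Hypothesis lDl : forall (a : R) x y, l (a *: x + y) = a * l x + l y.
Hypothesis l_le : forall x, `|l x| <= c * ip_norm ip x.

Let J x := ip x x - 2 * l x.

Let J_ge x : - c ^+ 2 <= J x.
Proof.
have := l_le x; have : 0 <= ip_norm ip x by exact: sqrtr_ge0.
have : ip_norm ip x ^+ 2 = ip x x by rewrite sqr_sqrtr.
rewrite /J ler_norml; set t := ip_norm ip x => <- t0 /andP[_ lx].
by have := sqr_ge0 (t - c); nra.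
Qed.

Let m := inf (range J).

Let J_inf x : m <= J x.
Proof.
apply: ge_inf; last by exists x.
by exists (- c ^+ 2) => _ [y _ <-]; exact: J_ge.
Qed.

Let minimizing : exists u, forall n, J (u n) <= m + n.+1%:R^-1.
Proof.
suff /choice[u] : forall n : nat, exists x, J x <= m + n.+1%:R^-1 by exists u.
move=> n.
have hinf : has_inf (range J).
  split; first by exists (J 0), 0.
  by exists (- c ^+ 2) => _ [y _ <-]; exact: J_ge.
have n0 : 0 < n.+1%:R^-1 :> R by rewrite invr_gt0.
have [_ [x _ <-] Jx] := inf_adherent n0 hinf.
by exists x; exact: ltW.
Qed.

Let parallelogram x y :
  ip (x - y) (x - y) = 2 * J x + 2 * J y - 4 * J (2^-1 *: (x + y)).
Proof.
have lD a b : l (a + b) = l a + l b by rewrite -[a in LHS]scale1r lDl mul1r.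
have l0 : l 0 = 0 by have := lD 0 0; rewrite addr0; lra.
have lZ k a : l (k *: a) = k * l a by rewrite -[k *: a]addr0 lDl l0 addr0.
rewrite /J -scaleN1r lZ lD !(ipDl, ipDr, ipZl, ipZr) (ipC y x); lra.
Qed.

Let euler (u x : E) (e : R) : J u <= m + e ->
  (ip u x - l x) ^+ 2 <= e * (ip x x + 1).
Proof.
move=> Ju; set d := ip u x - l x; set q := ip x x.
have q0 : 0 <= q by exact: ip_ge0.
have q1 : 0 < q + 1 by lra.
(* the minimum over t is near - d / q, but q may vanish *)
set t := - d / (q + 1).
have := J_inf (t *: x + u).
rewrite /J lDl !(ipDl, ipDr, ipZl, ipZr) (ipC x u) -/q => Jt.
have tq : t * (q + 1) = - d by rewrite divfK// gt_eqF.
have : 0 <= e + 2 * t * d + t ^+ 2 * q by move: Ju; rewrite /J /d; nra.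
rewrite -(pmulr_lge0 _ q1).
nra.
Qed.

(** Riesz representation by Dirichlet's principle: the parallelogram identity
    makes a minimizing sequence of [J] Cauchy, and comparing [J (u n)] with its
    values on the line [u n + t x] shows that [ip (u n) x] tends to [l x]. *)
Lemma riesz_completion (ip00 : ip 0 0 = 0) : exists U : completion ip,
  forall x, completion_ip U (to_completion ip00 x) = l x.
Proof.
have [u Ju] := minimizing.
have cu : ip_cauchy ip u.
  move=> e e0; have [k ke] := natSinv_lt (divr_gt0 (exprn_gt0 2 e0) (ltr0Sn R 3)).
  have Jk i : (k <= i)%N -> J (u i) <= m + k.+1%:R^-1.
    move=> ki; rewrite (le_trans (Ju i))// lerD2l lef_pV2 ?posrE//.
    by rewrite ler_nat.
  exists k => i j ki kj.
  rewrite -(@ltr_pXn2r _ 2) ?nnegrE ?sqrtr_ge0 ?(ltW e0)// sqr_sqrtr//.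
  rewrite parallelogram; have := Jk _ ki; have := Jk _ kj.
  have := J_inf (2^-1 *: (u i + u j)); move: ke; set d := k.+1%:R^-1.
  by rewrite ltr_pdivlMr//; lra.
pose U : completion ip := exist _ (ip_class ip u) (ex_intro2 _ _ u cu erefl).
exists U => x.
rewrite (@completion_ip_cvg ip00 U _ x cu erefl); apply: cvg_lim => //.
apply/cvgrPdist_lt => e e0.
have q0 : 0 < ip x x + 1 by rewrite ltr_wpDl.
have [k ke] := natSinv_lt (divr_gt0 (exprn_gt0 2 e0) q0).
exists k => // n /= kn.
rewrite -(@ltr_pXn2r _ 2) ?nnegrE ?(ltW e0)// real_normK ?num_real//.
rewrite -sqrrN opprB (le_lt_trans (euler _ (Ju n)))//.
rewrite -ltr_pdivlMr// (le_lt_trans _ ke)// lef_pV2 ?posrE//.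
by rewrite ler_nat.
Qed.

End riesz_completion.

(** * Functions bounded below on balls *)

Lemma cvg_sumr (R : realType) (I : finType) T (F : set_system T) (FF : Filter F)
    (g : I -> T -> R) (l : I -> R) :
  (forall i, g i t @[t --> F] --> l i) ->
  \sum_i g i t @[t --> F] --> \sum_i l i.
Proof.
move=> gl; elim: (index_enum I) => [|i s IHs].
  rewrite big_nil (_ : (fun _ => _) = cst 0); first exact: cvg_cst.
  by apply/funext => t; rewrite big_nil.
rewrite big_cons (_ : (fun _ => _) = fun t => g i t + \sum_(j <- s) g j t).
  by apply: cvgD.
by apply/funext => t; rewrite big_cons.
Qed.

Lemma cvg_sqrB (R : realType) T (F : set_system T) (FF : Filter F)
    (g : T -> R) (l c : R) :
  g t @[t --> F] --> l -> (g t - c) ^+ 2 @[t --> F] --> (l - c) ^+ 2.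
Proof.
move=> gl; have glc : g t - c @[t --> F] --> l - c.
  by apply: cvgB => //; exact: cvg_cst.
exact: (cvgM glc glc).
Qed.

Section balls.
Context {R : realType} {N : nat}.
Implicit Types (Om K : set 'rV[R]_N).
Local Notation mu := (@lebesgue_measure_rV R N).

Lemma eball_open (x : 'rV[R]_N) r : open (eball x r).
Proof.
pose g (y : 'rV[R]_N) := \sum_(i < N) (y ord0 i - x ord0 i) ^+ 2.
rewrite (_ : eball x r = g @^-1` `]-oo, r ^+ 2[%classic); last first.
  by apply/seteqP; split=> y; rewrite /= in_itv.
apply: open_comp; last exact: interval_open.
move=> y _; apply: (cvg_sumr (nbhs_filter y)) => i.
have cy : (fun z : 'rV[R]_N => z ord0 i) @ nbhs y --> y ord0 i.
  exact: coord_continuous.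
exact: (cvg_sqrB (nbhs_filter y) cy).
Qed.

(** [ball] is a cube here, the norm being the maximum of the coordinates. *)
Lemma eball_sub_ball (x : 'rV[R]_N) r : 0 < r -> eball x r `<=` ball x r.
Proof.
move=> r0 y; rewrite /eball/= => xy; split=> // i j; rewrite ord1 /ball/= distrC.
rewrite -(@ltr_pXn2r _ 2) ?nnegrE ?(ltW r0)//.
rewrite (le_lt_trans _ xy)// real_normK ?num_real// (bigD1 j)//= lerDl.
by apply: sumr_ge0 => k _; exact: sqr_ge0.
Qed.

Lemma eball_center (x : 'rV[R]_N) r : 0 < r -> eball x r x.
Proof.
move=> r0; rewrite /eball/= big1 ?exprn_gt0// => i _.
by rewrite subrr expr0n.
Qed.

Lemma eball_compact (x : 'rV[R]_N) Om : open Om -> Om x ->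
  exists r, [/\ 0 < r, compact (closure (eball x r))
    & closure (eball x r) `<=` Om].
Proof.
move=> oOm Ox.
have /nbhs_ballP[e /= e0 eO] : nbhs x Om by exact: open_nbhs_nbhs.
exists (e / 2).
have e2 : 0 < e / 2 by rewrite divr_gt0.
split=> //.
  apply: bounded_closed_compact; last exact: closed_closure.
  exists (`|x| + e); split; first exact: num_real.
  move=> M eM y /(_ (ball y (e / 2))) [|z [xz yz]]; first exact: nbhsx_ballx.
  have : ball x e y.
    rewrite (splitr e); apply: (@ball_triangle _ _ z); first exact: eball_sub_ball.
    exact: ball_sym.
  rewrite -ball_normE/= => xy; rewrite (le_trans _ (ltW eM))//.
  rewrite -(subrK x y) addrC (le_trans (ler_normD _ _))// lerD2l.
  by rewrite distrC ltW.
move=> y /(_ (ball y (e / 2))) [|z [xz yz]]; first exact: nbhsx_ballx.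
apply: eO; rewrite (splitr e); apply: (@ball_triangle _ _ z).
  exact: eball_sub_ball.
exact: ball_sym.
Qed.

Lemma ess_inf_on_gt0P (B : set 'rV[R]_N) (f : 'rV[R]_N -> R) :
  (0 < ess_inf_on B f)%E <->
  exists2 c : R, 0 < c & {ae mu, forall x, B x -> c <= f x}.
Proof.
split=> [|[c c0 cf]]; last first.
  apply: (@lt_le_trans _ _ c%:E); first by rewrite lte_fin.
  apply: ereal_sup_ubound => /=.
  by apply: filterS cf => x cfx /cfx; rewrite lee_fin.
move=> /ereal_sup_gt[[c||] /= cf] //.
  by rewrite lte_fin => c0; exists c.
(* y = +oo bounds f below on B only if B is negligible *)
move=> _; exists 1 => //; apply: filterS cf => x cfx /cfx.
by rewrite leye_eq.
Qed.

(** A compact set is covered by finitely many balls whose closures are compact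
    subsets of [Om]; the least of the finitely many bounds works. *)
Lemma ae_lower_bound_compact Om K (f : 'rV[R]_N -> R) : open Om ->
  (forall (x : 'rV[R]_N) (r : R), 0 < r ->
     compact (closure (eball x r)) -> closure (eball x r) `<=` Om ->
     (0 < ess_inf_on (eball x r) f)%E) ->
  compact K -> K `<=` Om ->
  exists2 c : R, 0 < c & {ae mu, forall x, K x -> c <= f x}.
Proof.
move=> oOm finf cK KOm.
have /choice[r rP] x : exists r : R, Om x ->
    [/\ 0 < r, compact (closure (eball x r)) & closure (eball x r) `<=` Om].
  have [Ox|Ox] := pselect (Om x); last by exists 0.
  by have [r rP] := eball_compact oOm Ox; exists r.
move: cK; rewrite compact_cover => /(_ _ K (fun x => eball x (r x))).
case=> [x _|x Kx|D DK KD]; first exact: eball_open.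
  by exists x => //; apply: eball_center; have [] := rP x (KOm _ Kx).
have : exists2 c : R, 0 < c & {ae mu, forall x, forall i,
    i \in (finmap.enum_fset D) ->
    eball i (r i) x -> c <= f x}.
  have : {in finmap.enum_fset D, forall x, Om x}.
    by move=> x /DK; rewrite inE => /KOm.
  elim: (finmap.enum_fset D) => [_|y s IHs sOm].
    by exists 1 => //; apply: aeW.
  have [c c0 cf] : exists2 c : R, 0 < c & {ae mu, forall x, forall i, i \in s ->
      eball i (r i) x -> c <= f x}.
    by apply: IHs => x xs; apply: sOm; rewrite inE xs orbT.
  have [r0 rc rO] := rP y (sOm _ (mem_head _ _)).
  have /ess_inf_on_gt0P[c' c'0 c'f] := finf _ _ r0 rc rO.
  exists (Num.min c c'); first by rewrite lt_min c0.
  apply: filterS2 cf c'f => x cfx c'fx i; rewrite inE => /orP[/eqP ->|/cfx {}cfx] xB.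
    by rewrite ge_min c'fx ?orbT.
  by rewrite ge_min cfx.
case=> c c0 cf; exists c => //; apply: filterS cf => x cfx /KD[i iD xB].
exact: cfx iD xB.
Qed.

End balls.

(** * Energy solutions yield subcriticality *)

Lemma le_Rintegral_ae d (T : measurableType d) (R : realType)
    (mu : {measure set T -> \bar R}) (D : set T) (f g : T -> R) : measurable D ->
  mu.-integrable D (EFin \o f) -> mu.-integrable D (EFin \o g) ->
  {ae mu, forall x, D x -> f x <= g x} ->
  \int[mu]_(x in D) f x <= \int[mu]_(x in D) g x.
Proof.
move=> mD fD gD fg; rewrite -subr_ge0 -RintegralB//.
have gfD : mu.-integrable D (EFin \o (fun x => g x - f x)).
  have H := integrableB mD gD fD; exact: H.
have mgf : measurable_fun D (fun x => g x - f x).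
  exact/measurable_EFinP/(measurable_int mu gfD).
(* almost everywhere g - f equals its absolute value, which is nonnegative
   at every point *)
rewrite [leRHS](_ : _ = \int[mu]_(x in D) `|g x - f x|).
  exact: Rintegral_ge0.
rewrite /Rintegral; congr fine; apply: ae_eq_integral => //.
- exact/measurable_EFinP.
- by apply/measurable_EFinP; exact: measurableT_comp.
by apply: filterS fg => x fgx Dx; rewrite ger0_norm// subr_ge0 fgx.
Qed.

Section subcritical_estimate.
Context {R : realType} {N : nat} {Om : set 'rV[R]_N} {V : 'rV[R]_N -> R}.
Hypotheses (oOm : open Om) (VOm : L1loc Om V) (QV : Q_nonneg Om V).
Implicit Types (xi phi : test_fun Om) (K : set 'rV[R]_N).
Local Notation mu := (@lebesgue_measure_rV R N).
Local Notation E := (@energy _ _ Om V).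

Let EC := @energyC R N Om V.
Let EDl := energyDl oOm VOm.
Let EZl := energyZl oOm VOm.
Let E_ge0 xi : 0 <= E xi xi. Proof. by rewrite energyE QV. Qed.

Lemma energy_ipcs xi phi : `|energy V xi phi| <= ip_norm E xi * ip_norm E phi.
Proof. exact: (ip_cauchy_schwarz EC EDl EZl E_ge0). Qed.

Lemma a_V_bounded (u : H_V Om V) : exists2 M : R, 0 <= M &
  forall xi, a_V u (incl_H_V V xi) <= M * Num.sqrt (Q V xi).
Proof.
have [w cw uw] := svalP u.
have [M wM] := ip_cauchy_bounded EC EDl EZl E_ge0 cw.
have M0 : 0 <= M by apply: le_trans (wM 0); exact: sqrtr_ge0.
exists M => // xi.
rewrite /a_V /incl_H_V (@completion_ip_cvg _ _ _ EC EDl EZl E_ge0 _ u w)//.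
apply: limr_le.
  apply: (is_cvg_ip EC EDl EZl E_ge0 cw).
  exact: ip_cauchy_cst (energy00 Om V) xi.
near=> n.
rewrite (le_trans (ler_norm _))// (le_trans (energy_ipcs _ _))//.
by rewrite -energyE -/(ip_norm E xi) ler_wpM2r ?sqrtr_ge0.
Unshelve. all: by end_near.
Qed.

Lemma Rintegral_indic_mul K (f : 'rV[R]_N -> R) : K `<=` Om ->
  \int[mu]_(x in Om) (\1_K x * f x) = \int[mu]_(x in K) f x.
Proof.
move=> KOm; rewrite Rintegral_mkcond [RHS]Rintegral_mkcond.
apply: eq_Rintegral => x _.
rewrite !patchE indicE; have [xK|xK] := boolP (x \in K).
  by rewrite mul1r ifT// inE; apply: KOm; rewrite inE in xK.
by rewrite mul0r if_same.
Qed.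

Lemma L1loc_indic K : compact K -> L1loc Om (\1_K : 'rV[R]_N -> R).
Proof.
move=> cK; have mK := compact_measurable_rV cK.
split; first exact: measurable_indic.
move=> K' cK' _; apply: measurable_bounded_integrable.
- exact: compact_measurable_rV.
- exact: compact_finite_measure.
- exact: measurable_indic.
apply: (@bounded_by _ _ _ _ 1) => x.
by rewrite indicE /=; case: (_ \in _); rewrite ?normr1 ?normr0.
Qed.

(** Test the equation with [|xi|]. The constant [c] that bounds [f] below on [K]
    enters the estimate. Outside [K] only the sign of [f] matters, and only on
    the support of [xi], which is compact as well. *)
Lemma energy_solution_subcritical (u : H_V Om V) (f : 'rV[R]_N -> R) :
  L1loc Om f ->
  (forall (x : 'rV[R]_N) (r : R), 0 < r ->
     compact (closure (eball x r)) -> closure (eball x r) `<=` Om ->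
     (0 < ess_inf_on (eball x r) f)%E) ->
  energy_solution u f -> L1_subcritical Om V.
Proof.
move=> fOm finf uf; split=> // K cK KOm.
have [c c0 cf] := ae_lower_bound_compact oOm finf cK KOm.
have [M M0 uM] := a_V_bounded u.
exists (c^-1 * M) => xi; rewrite -mulrA -ler_pdivrMl ?invr_gt0// invrK.
set phi := test_fun_norm xi.
apply: (@le_trans _ _ (\int[mu]_(x in Om) (f x * phi x))); last first.
  rewrite -uf (le_trans (uM _))// ler_wpM2l// ler_wsqrtr//.
  exact: Q_norm_le.
have mOm := open_measurable_rV oOm.
have K1 := integrable_test_mul oOm phi (L1loc_indic cK).
rewrite -Rintegral_indic_mul// -RintegralZl//.
apply: le_Rintegral_ae => //.
- exact: integrableZl_EFin.
- exact: integrable_test_mul.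
have [_ cS SOm] := test_fun_props phi.
have [d d0 df] := ae_lower_bound_compact oOm finf cS SOm.
apply: filterS2 cf df => x cfx dfx Omx.
rewrite mulrA indicE; have [xK|xK] := boolP (x \in K).
  by rewrite mulr1 ler_wpM2r//; apply: cfx; rewrite inE in xK.
rewrite mulr0 mul0r; have [xS|xS] := pselect (supp phi x); last first.
  by rewrite (supp_eq0 xS) mulr0.
by apply: mulr_ge0; [exact: le_trans (ltW d0) (dfx xS)|exact: normr_ge0].
Qed.

End subcritical_estimate.

(** * Subcriticality yields energy solutions *)

Section compact_exhaustion.
Context {R : realType} {n : nat}.
Implicit Types (Om K : set 'rV[R]_n).

(** The margin around [x] is prescribed uniformly so that the set is closed. *)
Definition exhaustion Om (k : nat) : set 'rV[R]_n :=
  [set x | `|x| <= k%:R /\ ball x k.+1%:R^-1 `<=` Om].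

Lemma exhaustion_sub Om k : exhaustion Om k `<=` Om.
Proof. by move=> x [_]; apply; apply: ballxx; rewrite invr_gt0. Qed.

Lemma exhaustion_compact Om k : compact (exhaustion Om k).
Proof.
apply: bounded_closed_compact.
  exists k%:R; split; first exact: num_real.
  by move=> M kM x [xk _]; exact: le_trans (ltW kM).
move=> x xcl.
have near_x (e : R) : 0 < e -> exists2 z, exhaustion Om k z & `|x - z| < e.
  move=> e0; have [z [zk xz]] := xcl _ (nbhsx_ballx x e e0).
  by exists z => //; move: xz; rewrite -ball_normE.
split.
  rewrite leNgt; apply/negP => kx.
  have [|z [zk _]] := near_x (`|x| - k%:R); first by rewrite subr_gt0.
  by have := ler_normD (x - z) z; rewrite subrK; lra.
move=> y; rewrite -ball_normE/= => xy.
have [|z [_ zOm] xz] := near_x (k.+1%:R^-1 - `|x - y|); first by rewrite subr_gt0.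
apply: zOm; rewrite -ball_normE/=.
have := ler_distD x z y; rewrite (distrC z x).
by move: xz; set d := k.+1%:R^-1; lra.
Qed.

Lemma compact_sub_exhaustion Om K : open Om -> compact K -> K `<=` Om ->
  exists k, K `<=` exhaustion Om k.
Proof.
move=> oOm cK KOm.
have [d d0 Kd] := compact_margin cK oOm KOm.
have [M M0 MK] := compact_norm_le cK.
have [j jd] := natSinv_lt d0.
have jM := archi_boundP M0.
set i := Num.bound _ in jM.
exists (i + j)%N => x Kx; split.
  rewrite (le_trans (MK _ Kx))// ltW// (lt_le_trans jM)//.
  by rewrite ler_nat leq_addr.
apply: subset_trans (Kd _ Kx); apply: le_ball.
rewrite (le_trans _ (ltW jd))// lef_pV2 ?posrE//.
by rewrite ler_nat ltnS leq_addl.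
Qed.

End compact_exhaustion.

Section positive_source.
Context {R : realType} {N : nat} {Om : set 'rV[R]_N} {V : 'rV[R]_N -> R}.
Hypothesis (oOm : open Om).
Implicit Types (xi phi : test_fun Om) (K : set 'rV[R]_N).
Local Notation mu := (@lebesgue_measure_rV R N).
Variable C : nat -> R.
Hypothesis HC : forall k xi,
  \int[mu]_(x in exhaustion Om k) `|xi x| <= C k * Num.sqrt (Q V xi).

(* the geometric factor makes the sum f of the b k bounded, the other one
   absorbs C k, which may have any sign *)
Let b k : R := (1 + `|C k|)^-1 / (2 ^ k.+1)%:R.

Let C1 k : 0 < 1 + `|C k|. Proof. by rewrite ltr_pwDl. Qed.

Let b_gt0 k : 0 < b k.
Proof. by rewrite /b divr_gt0 ?invr_gt0 ?C1// ltr0n expn_gt0. Qed.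

Let b_le k : b k <= 1 / (2 ^ k.+1)%:R.
Proof. by rewrite /b ler_wpM2r ?invr_ge0// invf_le1 ?C1// lerDl. Qed.

Let bC_le k s : 0 <= s -> b k * (C k * s) <= s / (2 ^ k.+1)%:R.
Proof.
move=> s0; rewrite /b mulrAC ler_wpM2r ?invr_ge0// mulrC.
rewrite ler_pdivrMr ?C1// mulrC ler_wpM2l//.
by have := ler_norm (C k); lra.
Qed.

Let mK k : measurable (exhaustion Om k).
Proof. by apply: compact_measurable_rV; exact: exhaustion_compact. Qed.

Let F x : \bar R := (\sum_(k <oo) (b k * \1_(exhaustion Om k) x)%:E)%E.

Let f x : R := fine (F x).

Let term_ge0 k x : (0 <= (b k * \1_(exhaustion Om k) x)%:E)%E.
Proof. by rewrite lee_fin mulr_ge0 ?(ltW (b_gt0 _)). Qed.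

Let F_le1 x : (F x <= 1)%E.
Proof.
apply: (le_trans _ (@epsilon_trick0 R 1 xpredT ler01)).
apply: lee_nneseries => // k _; rewrite lee_fin (le_trans _ (b_le k))//.
by rewrite ler_piMr ?(ltW (b_gt0 _))// indicE; case: (_ \in _).
Qed.

Let F_ge0 x : (0 <= F x)%E.
Proof. exact: nneseries_ge0. Qed.

Let fE x : (f x)%:E = F x.
Proof. by rewrite fineK// ge0_fin_numE// (le_lt_trans (F_le1 x))// ltry. Qed.

Let f_ge0 x : 0 <= f x. Proof. by rewrite -lee_fin fE. Qed.

Let f_le1 x : f x <= 1. Proof. by rewrite -lee_fin fE. Qed.

Let f_ge k x : exhaustion Om k x -> b k <= f x.
Proof.
move=> xk; rewrite -lee_fin fE.
apply: (le_trans _ (nneseries_lim_ge k.+1 _)) => //.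
rewrite big_nat_recr//= indicE mem_set// mulr1.
by rewrite leeDr// sume_ge0.
Qed.

Let mterm k : measurable_fun setT (fun x => (b k * \1_(exhaustion Om k) x)%:E).
Proof. by apply/measurable_EFinP; apply: measurable_funM. Qed.

Let measurable_f : measurable_fun setT f.
Proof.
apply: measurableT_comp => //.
exact: (@ge0_emeasurable_sum _ _ _ _
  (fun k x => (b k * \1_(exhaustion Om k) x)%:E) xpredT).
Qed.

Let source_L1loc : L1loc Om f.
Proof.
split; first exact: measurable_funTS.
move=> K cK _; apply: measurable_bounded_integrable.
- exact: compact_measurable_rV.
- exact: compact_finite_measure.
- exact: measurable_funTS.
by apply: (@bounded_by _ _ _ _ 1) => x; rewrite ger0_norm.
Qed.

Let source_pos x r : compact (closure (eball x r)) ->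
  closure (eball x r) `<=` Om -> (0 < ess_inf_on (eball x r) f)%E.
Proof.
move=> cB BOm; have [k Bk] := compact_sub_exhaustion oOm cB BOm.
apply/ess_inf_on_gt0P; exists (b k) => //.
by apply: aeW => y xy; apply/f_ge/Bk/subset_closure.
Qed.

(* monotone convergence turns the integral of f |xi| into a series whose k-th
   term is at most sqrt (Q xi) / 2 ^ k.+1 *)
Let source_bounded xi :
  `|\int[mu]_(x in Om) (f x * xi x)| <= Num.sqrt (Q V xi).
Proof.
have mOm := open_measurable_rV oOm.
have ifxi := integrable_test_mul oOm xi source_L1loc.
rewrite (le_trans (le_normr_Rintegral mOm ifxi))// -lee_fin.
set phi := test_fun_norm xi.
have EFin_Rintegral (g : 'rV[R]_N -> R) : mu.-integrable Om (EFin \o g) ->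
    (\int[mu]_(x in Om) g x)%:E = (\int[mu]_(x in Om) (g x)%:E)%E.
  by move=> ig; rewrite /Rintegral fineK//; exact: integrable_fin_num ig.
have itm k : mu.-integrable Om
    (EFin \o (fun x => b k * (\1_(exhaustion Om k) x * phi x))).
  apply: (integrableZl_EFin _ mOm).
  apply: integrable_test_mul => //; apply: L1loc_indic; exact: exhaustion_compact.
rewrite EFin_Rintegral; last by have := integrable_norm ifxi.
rewrite (@eq_integral _ _ _ mu Om (fun x =>
    \sum_(k <oo) (b k * (\1_(exhaustion Om k) x * phi x))%:E)%E); last first.
  move=> x _; rewrite normrM ger0_norm// mulrC EFinM fE -nneseriesZl//.
  by apply: eq_eseriesr => k _; rewrite -EFinM; congr EFin; rewrite mulrC mulrA.
rewrite integral_nneseries//; first last.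
- move=> k x _; rewrite lee_fin mulr_ge0 ?(ltW (b_gt0 _))// mulr_ge0//.
  exact: normr_ge0.
- by move=> k; exact: measurable_int (itm k).
apply: le_trans (epsilon_trick0 xpredT (sqrtr_ge0 (Q V xi))).
apply: lee_nneseries => [k _ _|k _].
  rewrite -EFin_Rintegral// lee_fin; apply: Rintegral_ge0 => x _.
  by rewrite mulr_ge0 ?(ltW (b_gt0 _))// mulr_ge0//; exact: normr_ge0.
rewrite -EFin_Rintegral// lee_fin RintegralZl//; last first.
  apply: integrable_test_mul => //; apply: L1loc_indic; exact: exhaustion_compact.
rewrite Rintegral_indic_mul; last exact: exhaustion_sub.
apply: le_trans (bC_le k (sqrtr_ge0 _)); rewrite ler_wpM2l ?(ltW (b_gt0 _))//.
exact: HC.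
Qed.

(** The source is [f], the sum of the [b k] times the indicators of an
    exhaustion. It is bounded below on a compact set by any [b k] whose set
    contains it. *)
Lemma exists_positive_source : exists g : 'rV[R]_N -> R, [/\ L1loc Om g,
  (forall (x : 'rV[R]_N) (r : R), 0 < r -> compact (closure (eball x r)) ->
     closure (eball x r) `<=` Om -> (0 < ess_inf_on (eball x r) g)%E) &
  forall xi, `|\int[mu]_(x in Om) (g x * xi x)| <= Num.sqrt (Q V xi)].
Proof.
exists f; split; [exact: source_L1loc| |exact: source_bounded].
by move=> x r _; exact: source_pos.
Qed.

End positive_source.

Lemma subcritical_energy_solution (R : realType) (N : nat) (Om : set 'rV[R]_N)
    (V : 'rV[R]_N -> R) : open Om -> L1loc Om V -> L1_subcritical Om V ->
  exists (u : H_V Om V) (f : 'rV[R]_N -> R),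
    [/\ L1loc Om f,
        (forall (x : 'rV[R]_N) (r : R), 0 < r ->
           compact (closure (eball x r)) -> closure (eball x r) `<=` Om ->
           (0 < ess_inf_on (eball x r) f)%E)
      & energy_solution u f].
Proof.
move=> oOm VOm [QV KC].
have /choice[C HC] k := KC _ (@exhaustion_compact R N Om k) (@exhaustion_sub R N Om k).
have [f [fOm fpos fQ]] := exists_positive_source oOm HC.
pose l (xi : test_fun Om) : R := \int[lebesgue_measure_rV]_(x in Om) (f x * xi x).
have mOm := open_measurable_rV oOm.
have ifx xi := integrable_test_mul oOm xi fOm.
have l_lin (a : R) (xi phi : test_fun Om) : l (a *: xi + phi) = a * l xi + l phi.
  rewrite /l -RintegralZl// -RintegralD//; last exact: integrableZl_EFin.
  by apply: eq_Rintegral => x _; rewrite /= !fctE /GRing.scale/=; ring.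
have l_le xi : `|l xi| <= 1 * ip_norm (@energy _ _ Om V) xi.
  by rewrite mul1r /ip_norm energyE; exact: fQ.
have E_ge0 xi : 0 <= @energy _ _ Om V xi xi by rewrite energyE QV.
have [u ul] := riesz_completion (@energyC _ _ Om V) (energyDl oOm VOm)
  (energyZl oOm VOm) E_ge0 l_lin l_le (energy00 Om V).
by exists u, f; split=> // xi; exact: ul.
Qed.

Theorem proposition8p11 (R : realType) (N : nat) (Om : set 'rV[R]_N)
    (V : 'rV[R]_N -> R) :
  (1 <= N)%N -> domain Om -> L1loc Om V -> Q_nonneg Om V ->
  L1_subcritical Om V <->
  exists (u : H_V Om V) (f : 'rV[R]_N -> R),
    [/\ L1loc Om f,
        (forall (x : 'rV[R]_N) (r : R), 0 < r ->
           compact (closure (eball x r)) -> closure (eball x r) `<=` Om ->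
           (0 < ess_inf_on (eball x r) f)%E)
      & energy_solution u f].
Proof.
move=> _ [_ oOm _] VOm QV; split; first exact: subcritical_energy_solution.
move=> [u [f [fOm finf uf]]].
exact: (energy_solution_subcritical oOm VOm QV fOm finf uf).
Qed.
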